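(* A prime end $[E_k]$ of $\Omega$ is a singleton end if and only if its impression $I[E_k]$ contains a point which is accessible through $[E_k]$.
   Context: Setting: $(X,d,\mu)$ is a metric measure space with more than one point, $\mu$ is a Borel measure with $0<\mu(B)<\infty$ for all balls $B$, and $1\le p<\infty$ is fixed. $X$ is complete, $\mu$ is doubling (there is $C_\mu>0$ with $\mu(B(x,2r))\le C_\mu\mu(B(x,r))$ for all balls), and $X$ supports a $p$-Poincaré inequality: there are $C_{PI}>0$, $\lambda\ge1$ such that for all balls $B$ and all $u\in N^{1,p}(X)$, $\frac{1}{\mu(B)}\int_B|u-u_B|\,d\mu\le C_{PI}\operatorname{diam}(B)\bigl(\frac{1}{\mu(\lambda B)}\int_{\lambda B}g_u^p\,d\mu\bigr)^{1/p}$, where $u_B=\frac{1}{\mu(B)}\int_B u\,d\mu$. Here a nonnegative Borel function $g$ is an upper gradient of $u:X\to[-\infty,\infty]$ if for every nonconstant rectifiable curve $\gamma:[0,l_\gamma]\to X$ parameterized by arc length, $|u(\gamma(0))-u(\gamma(l_\gamma))|\le\int_\gamma g\,ds$ when both values are finite, and $\int_\gamma g\,ds=\infty$ otherwise; $N^{1,p}(X)$ is the space of measurable $u$ with $\int_X|u|^p\,d\mu+\inf_g\int_X g^p\,d\mu<\infty$ (infimum over upper gradients $g$ of $u$), and $g_u$ is the minimal $p$-weak upper gradient of $u$ (the a.e.-smallest $L^p$ function satisfying the upper gradient inequality for all curves except a family $\Gamma$ for which some nonnegative Borel $\rho\in L^p(X)$ has $\int_\gamma\rho\,ds=\infty$ for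 all $\gamma\in\Gamma$). $\Omega\subsetneq X$ is a bounded domain (bounded nonempty connected open set); closures and boundaries of subsets of $\Omega$ are taken in $X$. Ends: A bounded connected set $E\subsetneq\Omega$ is acceptable if $\overline E\cap\partial\Omega\ne\varnothing$. A sequence $\{E_k\}_{k=1}^\infty$ of acceptable sets is a chain if (i) $E_{k+1}\subset E_k$ for all $k$; (ii) $\operatorname{dist}(\Omega\cap\partial E_{k+1},\Omega\cap\partial E_k)>0$ for all $k$; (iii) the impression $\bigcap_{k=1}^\infty\overline{E}_k$ is contained in $\partial\Omega$. A chain $\{E_k\}$ divides a chain $\{F_k\}$ if for each $k$ there is $l$ with $E_l\subset F_k$. Two chains are equivalent if they divide each other; an end $[E_k]$ is an equivalence class of chains, and its impression $I[E_k]$ is the impression of any representative chain. Division is well defined between ends. A prime end is an end that is not divisible by any other end. A singleton end is an end whose impression is a single point. Accessibility: $x\in\partial\Omega$ is accessible through $[E_k]$ if there is a (possibly nonrectifiable) curve $\gamma:[0,1]\to X$ with $\gamma(1)=x$, $\gamma([0,1))\subset\Omega$, such that for every $k$ there is $0<t_k<1$ with $\gamma([t_k,1))\subset E_k$. *)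

(* Defs.v *)
From HB Require Import structures.
From mathcomp Require Import all_boot all_order all_algebra.
From mathcomp Require Import all_classical all_reals all_analysis.
From mathcomp Require Import measurable_realfun.

Set Implicit Arguments.
Unset Strict Implicit.
Unset Printing Implicit Defensive.

Import Order.TTheory GRing.Theory Num.Theory.
Import numFieldNormedType.Exports.

Local Open Scope classical_set_scope.
Local Open Scope ring_scope.

(* A base point is needed by the measurable types of MathComp-Analysis; it
   plays no other role. *)
#[short(type="pointedMetricType")]
HB.structure Definition PointedMetric (R : numDomainType) :=
  {T of Metric R T & isPointed T}.

#[short(type="completeMetricType")]
HB.structure Definition CompleteMetric (R : numDomainType) :=
  {T of PointedMetric R T & Complete T}.

Definition boundary {T : topologicalType} (A : set T) : set T :=
  closure A `\` A°.

Section metric.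
Context {R : realType} {X : metricType R}.
Implicit Types A B : set X.

Definition metric_bounded A : Prop := exists x r, A `<=` ball x r.

Definition diameter A : \bar R :=
  ereal_sup [set (mdist x y)%:E | x in A & y in A].

(* The distance to the empty set is +oo. *)
Definition set_dist A B : \bar R :=
  ereal_inf [set (mdist x y)%:E | x in A & y in B].

Definition polygonal_length (gamma : R -> X) (a b : R) (s : seq R) : R :=
  let F := gamma \o nth b (a :: s) in
  \sum_(0 <= n < size s) mdist (F n) (F n.+1).

Definition curve_length (gamma : R -> X) (a b : R) : \bar R :=
  ereal_sup [set (polygonal_length gamma a b s)%:E | s in itv_partition a b].

Definition bounded_domain (Omega : set X) : Prop :=
  [/\ metric_bounded Omega, Omega !=set0, connected Omega & open Omega].

End metric.

(* Nonconstant rectifiable curves [0, l] -> X parameterized by arc length;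
   the values of arc_fun outside [0, l] are irrelevant. *)
Record arc_curve (R : realType) (X : metricType R) := ArcCurve {
  arc_len : R ;
  arc_fun :> R -> X ;
  arc_len_gt0 : 0 < arc_len ;
  arc_continuous : {within `[0, arc_len], continuous arc_fun} ;
  arc_length_param : forall s t, 0 <= s -> s <= t -> t <= arc_len ->
    curve_length arc_fun s t = (t - s)%:E
}.
Arguments arc_curve {R} X.

Definition borel {R : realType} (X : pointedMetricType R) :=
  g_sigma_algebraType (@open X).

Section sobolev.
Local Open Scope ereal_scope.
Context {R : realType} {X : pointedMetricType R}.
Variables (mu : {measure set (borel X) -> \bar R}) (p : R).
Implicit Types (u g rho : X -> \bar R) (A : set X) (gamma : arc_curve X).

Definition borel_fun u : Prop :=
  measurable_fun [set: borel X] (u : borel X -> \bar R).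

Definition nonneg_borel g : Prop := borel_fun g /\ forall x, 0 <= g x.

Definition curve_integral g gamma : \bar R :=
  \int[lebesgue_measure]_(s in `[0%R, arc_len gamma]) g (gamma s).

Definition upper_gradient_along u g gamma : Prop :=
  let a := u (gamma 0%R) in let b := u (gamma (arc_len gamma)) in
  let both_finite := (a \is a fin_num) && (b \is a fin_num) in
  (both_finite -> `|a - b| <= curve_integral g gamma) /\
  (~~ both_finite -> curve_integral g gamma = +oo).

Definition upper_gradient u g : Prop :=
  nonneg_borel g /\ forall gamma, upper_gradient_along u g gamma.

Definition p_energy u : \bar R := \int[mu]_x (`|u x| `^ p).

Definition exceptional (Gamma : set (arc_curve X)) : Prop :=
  exists rho, [/\ nonneg_borel rho, p_energy rho < +oo &
    forall gamma, Gamma gamma -> curve_integral rho gamma = +oo].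

Definition weak_upper_gradient u g : Prop :=
  nonneg_borel g /\ exists2 Gamma, exceptional Gamma &
    forall gamma, ~ Gamma gamma -> upper_gradient_along u g gamma.

Definition minimal_weak_upper_gradient u g : Prop :=
  [/\ weak_upper_gradient u g, p_energy g < +oo &
    forall g', weak_upper_gradient u g' -> p_energy g' < +oo ->
      {ae mu, forall x, g x <= g' x}].

Definition newtonian u : Prop :=
  borel_fun u /\
  p_energy u + ereal_inf [set p_energy g | g in upper_gradient u]
    < +oo.

Definition mean A u : \bar R := (mu A)^-1 * \int[mu]_(x in A) u x.

Definition balls_pos_finite : Prop :=
  forall (x : X) (r : R), (0 < r)%R -> 0 < mu (ball x r) < +oo.

Definition doubling : Prop :=
  exists2 C : R, (0 < C)%R & forall (x : X) (r : R), (0 < r)%R ->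
    mu (ball x (2 * r)%R) <= C%:E * mu (ball x r).

(* The minimal weak upper gradient g_u of a Newtonian function exists and is
   unique up to null sets, so that the inequality does not depend on g. *)
Definition poincare : Prop :=
  exists C lam : R, [/\ (0 < C)%R, (1 <= lam)%R &
    forall (x : X) (r : R) u, (0 < r)%R -> newtonian u ->
    exists2 g, minimal_weak_upper_gradient u g &
      let B := ball x r in let lamB := ball x (lam * r)%R in
      mean B (fun y => `|u y - mean B u|) <=
        C%:E * diameter B * mean lamB (fun y => g y `^ p) `^ p^-1].

End sobolev.

Section ends.
Context {R : realType} {X : metricType R}.
Variable Omega : set X.
Implicit Types (E F : nat -> set X) (e f : set (nat -> set X)).

Definition acceptable (A : set X) : Prop :=
  [/\ metric_bounded A, connected A, A `<` Omega &
      closure A `&` boundary Omega !=set0].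

Definition chain_impression E : set X := \bigcap_k closure (E k).

Definition is_chain E : Prop :=
  [/\ forall k, acceptable (E k),
      forall k, E k.+1 `<=` E k,
      forall k, (0 < set_dist (Omega `&` boundary (E k.+1))
                              (Omega `&` boundary (E k)))%E &
      chain_impression E `<=` boundary Omega].

Definition chain_divides E F : Prop := forall k, exists l, E l `<=` F k.

Definition chain_equiv E F : Prop := chain_divides E F /\ chain_divides F E.

(* The end [E_k], as an equivalence class of chains. *)
Definition end_of E : set (nat -> set X) :=
  [set F | is_chain F /\ chain_equiv E F].

Definition is_end e : Prop := exists2 E, is_chain E & e = end_of E.

Definition end_divides e f : Prop :=
  exists E F, [/\ e E, f F & chain_divides E F].

Definition prime_end e : Prop :=
  is_end e /\ forall f, is_end f -> end_divides f e -> f = e.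

(* All chains of an end have the same impression, see end_impressionE. *)
Definition end_impression e : set X := \bigcap_(E in e) chain_impression E.

Definition singleton_end e : Prop :=
  is_end e /\ exists x, end_impression e = [set x].

Definition accessible_through E (x : X) : Prop :=
  boundary Omega x /\
  exists gamma : R -> X, [/\ {within `[0, 1], continuous gamma},
    gamma 1 = x,
    forall t, 0 <= t -> t < 1 -> Omega (gamma t) &
    forall k, exists tk : R, [/\ 0 < tk, tk < 1 &
      forall t, tk <= t -> t < 1 -> E k (gamma t)]].

Lemma chain_divides_refl E : chain_divides E E.
Proof. by move=> k; exists k. Qed.

Lemma chain_divides_trans E F G :
  chain_divides E F -> chain_divides F G -> chain_divides E G.
Proof.
move=> EF FG k; have [l Fl] := FG k; have [m Em] := EF l.
by exists m; exact: subset_trans Em Fl.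
Qed.

Lemma chain_divides_impression E F :
  chain_divides E F -> chain_impression E `<=` chain_impression F.
Proof.
move=> EF x Ex k _; have [l El] := EF k.
exact: (closure_subset El) (Ex l I).
Qed.

Lemma end_impressionE E :
  is_chain E -> end_impression (end_of E) = chain_impression E.
Proof.
move=> cE; apply/seteqP; split=> x.
  by apply; split=> //; split; exact: chain_divides_refl.
by move=> Ex F [_ [EF _]]; exact: chain_divides_impression EF _ Ex.
Qed.

Lemma end_dividesE E F : is_chain E -> is_chain F ->
  end_divides (end_of E) (end_of F) <-> chain_divides E F.
Proof.
move=> cE cF; split=> [[E' [F' [[_ [EE' _]] [_ [_ F'F]] E'F']]]|EF].
  by apply: chain_divides_trans EE' _; apply: chain_divides_trans E'F' F'F.
by exists E, F; split=> //; split=> //; split; exact: chain_divides_refl.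
Qed.

End ends.

(* Main.v *)
Require Import Defs.
From mathcomp Require Import all_boot all_order all_algebra.
From mathcomp Require Import all_classical all_reals all_analysis.
From mathcomp Require Import measurable_realfun.
From mathcomp Require Import ring lra.

(* The Poincare inequality enters only through connectivity. If V is clopen in
   a ball B(x, r) and contains x, cut off the indicator of V near the boundary
   of the ball: the result has an upper gradient that vanishes on B(x, r/2), so
   it is constant almost everywhere on B(x, r/(2 lambda)), which therefore lies
   in V. Hence quasicomponents of open sets are open and connected, components
   of open sets are open, and nearby points are joined by chains of arbitrarily
   small step in a ball of comparable radius. Refining such chains repeatedly
   and using completeness produces curves, so that connected open sets are path
   connected.

   If the impression is {x}, then closed balls being compact the sets E_k shrink
   to x. Consecutive boundaries being disjoint, E_{k+1} lies in the interior of
   E_k, so points of E_{k+1} are joined by curves in E_k; concatenating such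
   curves gives access to x. Conversely, if a curve gives access to x through
   [E_k], the components of Omega `&` B(x, r_k) that contain its tails form a
   chain with impression {x} that divides E_k, and primality makes it equivalent
   to E_k. *)

Set Implicit Arguments.
Unset Strict Implicit.
Unset Printing Implicit Defensive.

Import Order.TTheory GRing.Theory Num.Theory.
Import numFieldNormedType.Exports.

Local Open Scope classical_set_scope.
Local Open Scope ring_scope.

(** * Components of open sets *)

Section metric_topology.
Context {R : realType} {X : metricType R}.
Implicit Types (x y z : X) (A B U V W : set X) (r e c : R).

Lemma mball_open x r : open (ball x r).
Proof.
rewrite openE => y; rewrite ballEmdist /= => xy.
apply/nbhs_ballP; exists (r - mdist x y) => /=; first by rewrite subr_gt0.
move=> z; rewrite !ballEmdist /= => yz.
by have := metric_triangle x y z; lra.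
Qed.

Lemma open_ballP U :
  open U <-> forall x, U x -> exists2 r, 0 < r & ball x r `<=` U.
Proof.
split=> [oU x Ux|H]; last first.
  by rewrite openE => x /H [r r0 xrU]; apply/nbhs_ballP; exists r.
by have /nbhs_ballP[r /= r0 xrU] := open_nbhs_nbhs (conj oU Ux); exists r.
Qed.

(** The trace of [V] on [A] is open, and it is closed as the trace of the complement of [W]. The two
    open sets may overlap outside [A]. *)
Lemma connected_clopen A V W : connected A -> open V -> open W ->
  A `&` V `&` W = set0 -> A `<=` V `|` W -> A `&` V !=set0 -> A `<=` V.
Proof.
move=> cA oV oW AVW0 AVW AV0.
suff -> : A = A `&` V by exact: subIsetr.
apply/esym/cA => //; first by exists V.
exists (~` W); first exact: open_closedC.
apply/seteqP; split=> x [Ax].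
  by move=> Vx; split=> // Wx; rewrite -[False]/(set0 x) -AVW0.
by move=> nWx; split=> //; case: (AVW _ Ax).
Qed.

(** If [A] missed the boundary of [B], the interior and the exterior of [B] would cover it, and
    connectedness would put it into the interior. *)
Lemma connected_boundary A B : connected A -> A `&` B !=set0 ->
  ~ A `<=` B -> A `&` boundary B !=set0.
Proof.
move=> cA [a [Aa Ba]] nAB; apply: contrapT => /set0P/negP/negPn/eqP A0.
have dec x : A x -> B° x \/ (~` closure B) x.
  move=> Ax; apply: contrapT => /not_orP[nBx /contrapT cBx].
  by rewrite -[False]/(set0 x) -A0.
apply: nAB => x Ax; apply: interior_subset.
apply: (@connected_clopen A B° (~` closure B)) x Ax => //.
- exact: open_interior.
- exact/closed_openC/closed_closure.
- rewrite -subset0 => y [[_ /interior_subset By]]; apply.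
  exact: subset_closure.
- exists a; split=> //; case: (dec _ Aa) => // /(_ _)[].
  exact: subset_closure.
Qed.

(* The clopen pieces of a ball that contain the centre swallow a ball of
   comparable radius: this is all that is used of the Poincare inequality. *)
Definition ball_splitting c := forall x r V W, 0 < r -> open V -> open W ->
  V `&` W = set0 -> ball x r `<=` V `|` W -> V x -> ball x (r / c) `<=` V.

Definition quasicomponent U x := [set y | U y /\
  forall V W, open V -> open W -> V `&` W = set0 -> V `|` W = U -> V x -> V y].

(** A quasicomponent need not be connected in general. Here [ball_splitting] makes it open, and its
    complement in [U] is always open; so a clopen part of it is clopen in [U], and by definition no
    such part can separate it. *)
Lemma quasicomponent_connected U x c : 0 < c -> ball_splitting c ->
  open U -> U x -> connected (quasicomponent U x).
Proof.
move=> c0 bs oU Ux; set Q := quasicomponent U x.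
have oUQ : open (U `\` Q).
  apply/open_ballP => z [Uz /not_andP[//|]].
  move=> /existsNP[V /existsNP[W]].
  move=> /not_implyP[oV /not_implyP[oW /not_implyP[VW0 /not_implyP[VWU]]]].
  move=> /not_implyP[Vx nVz].
  have Wz : W z by move: Uz; rewrite -VWU => -[].
  have /open_ballP/(_ _ Wz)[r r0 rW] := oW.
  exists r => // w /rW Ww; split; first by rewrite -VWU; right.
  by move=> [_ /(_ _ _ oV oW VW0 VWU Vx) Vw]; rewrite -[False]/(set0 w) -VW0.
have oQ : open Q.
  apply/open_ballP => y [Uy Qy].
  have /open_ballP/(_ _ Uy)[r r0 rU] := oU.
  exists (Num.min r (r / c)); first by rewrite lt_min r0 divr_gt0.
  move=> z; rewrite ballEmdist /= lt_min => /andP[yzr yzrc]; split.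
    by apply: rU; rewrite ballEmdist.
  move=> V W oV oW VW0 VWU Vx.
  by apply: (bs y r V W) => //; [rewrite VWU|exact: (Qy V W)|rewrite ballEmdist].
move=> B B0 [C oC BC] [D cD BD].
have BQ : B `<=` Q by rewrite BC; exact: subIsetl.
have oB : open B by rewrite BC; exact: openI.
have oQB : open (Q `\` B).
  rewrite (_ : Q `\` B = Q `&` ~` D); first exact/openI/closed_openC.
  rewrite BD; apply/seteqP; split=> y [Qy nBy]; split=> //.
    by move=> Dy; exact: nBy.
  by move=> [].
have QU : Q `<=` U by move=> y [].
(* [B'] is the complement of [B] in [U], so that [B] and [B'] form a clopen splitting of [U]. *)
pose B' := (U `\` Q) `|` (Q `\` B).
have oB' : open B' by exact: openU.
have BB'0 : B `&` B' = set0.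
  by rewrite -subset0 => y [By [[_ /(_ (BQ _ By))]|[_ /(_ By)]]].
have BB'U : B `|` B' = U.
  apply/seteqP; split=> y.
    by move=> [/BQ/QU //|[[]//|[/QU]]].
  move=> Uy; have [By|nBy] := pselect (B y); first by left.
  right; rewrite /B'; have [Qy|nQy] := pselect (Q y); first by right.
  by left.
apply/seteqP; split=> // y [Uy Qy].
have [Bx|nBx] := pselect (B x); first exact: (Qy B B').
(* With [x] in [B'], the definition of [Q] forces the point [b] of [B] into [B'] as well. *)
have B'x : B' x by move: Ux; rewrite -BB'U => -[].
have [b Bb] := B0; have [_ /(_ B' B oB' oB)] := BQ _ Bb.
rewrite setIC setUC => /(_ BB'0 BB'U B'x) B'b.
by exfalso; rewrite -[False]/(set0 b) -BB'0.
Qed.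

(** A clopen splitting of [U] restricts to the ball, and the piece of [x] swallows the smaller ball.
    So this ball lies in the quasicomponent, which is connected. *)
Lemma component_ball U x c r : 0 < c -> ball_splitting c -> open U -> 0 < r ->
  ball x r `<=` U -> ball x (r / c) `<=` connected_component U x.
Proof.
move=> c0 bs oU r0 rU.
have Ux : U x by apply: rU; exact: ballxx.
have H := @connected_component_max _ U (quasicomponent U x) x.
apply: (subset_trans _ (H _ _ _)).
- move=> y xy; split.
    (* Against [set0], [ball_splitting] yields the inclusion of the smaller ball in [U]; here [c] is
       only known to be positive. *)
    by apply: (bs x r U set0) => //; rewrite ?setI0 ?setU0//; exact: open0.
  move=> V W oV oW VW0 VWU Vx.
  by apply: (bs x r V W) => //; rewrite VWU.
- by split.
- by move=> y [].
- exact: (quasicomponent_connected c0 bs).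
Qed.

Lemma component_open U x c : 0 < c -> ball_splitting c -> open U ->
  open (connected_component U x).
Proof.
move=> c0 bs oU; apply/open_ballP => y xy.
have Uy := connected_component_sub xy.
have /open_ballP/(_ _ Uy)[r r0 rU] := oU.
exists (r / c); first by rewrite divr_gt0.
by rewrite (same_connected_component xy); exact: component_ball rU.
Qed.

(** The [e]-neighbourhoods [V] and [W] of the reachable and of the unreachable points of [A] cannot
    meet inside [A]: one more step would reach an unreachable point. *)
Lemma connected_chain A a b e : connected A -> A a -> A b -> 0 < e ->
  exists (n : nat) (z : nat -> X), [/\ z 0%N = a, z n = b,
    forall i, (i <= n)%N -> A (z i) &
    forall i, (i < n)%N -> mdist (z i) (z i.+1) < e].
Proof.
move=> cA Aa Ab e0.
pose P b := exists (n : nat) (z : nat -> X), [/\ z 0%N = a, z n = b,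
    forall i, (i <= n)%N -> A (z i) &
    forall i, (i < n)%N -> mdist (z i) (z i.+1) < e].
have step y w : A w -> mdist y w < e -> P y -> P w.
  move=> Aw yw [n [z [z0 zn zA ze]]].
  exists n.+1, (fun i => if (i <= n)%N then z i else w); split=> //=.
  - by rewrite ltnn.
  - by move=> i _; case: ifPn => // /zA.
  - move=> i; rewrite ltnS => ilen; have /predU1P[->|lin] : (i == n) || (i < n)%N.
        by rewrite -leq_eqVlt.
      by rewrite leqnn ltnn zn.
    by rewrite ilen lin; exact: ze.
pose V := \bigcup_(y in A `&` P) ball y e.
pose W := \bigcup_(y in A `\` P) ball y e.
have oV : open V by apply: bigcup_open => y _; exact: mball_open.
have oW : open W by apply: bigcup_open => y _; exact: mball_open.
have Pa : P a.
  by exists 0%N, (fun=> a); split.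
have VP y : A y -> V y -> P y.
  move=> Ay [z [Az Pz]]; rewrite ballEmdist /= => zy.
  exact: step Pz.
apply: (VP b Ab).
apply: (@connected_clopen A V W) => //.
- rewrite -subset0 => y [[Ay Vy] [z [Az nPz] zy]]; apply: nPz.
  apply: (step y) => //; last exact: VP.
  by move: zy; rewrite ballEmdist /= metric_sym.
- move=> y Ay; have [Py|nPy] := pselect (P y); [left|right];
    by exists y => //; exact: ballxx.
- exists a; split=> //; exists a; [by split|exact: ballxx].
Qed.

End metric_topology.

(** * Curves from refined chains *)

(** Continuity on [[0, 1]] in epsilon-delta form, which suits refinement and pasting;
    [path01_within] converts it to the subspace topology. *)
Definition path01 {R : realType} {X : metricType R} (g : R -> X) :=
  forall t, 0 <= t <= 1 -> forall e, 0 < e -> exists2 d, 0 < d &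
    forall s, 0 <= s <= 1 -> `|s - t| < d -> mdist (g t) (g s) < e.

Lemma geometric_small {R : realType} (r e : R) : 0 <= r -> 0 < e ->
  exists m, r / 4 ^+ m < e.
Proof.
move=> r0 e0; exists (Num.trunc (r / e)).+1.
have := truncnS_gt (r / e); move: (_.+1) => m rm.
have m4 : m%:R <= 4 ^+ m :> R.
  by rewrite -natrX ler_nat ltnW// ltn_expl.
have p4 : 0 < 4 ^+ m :> R by rewrite exprn_gt0.
rewrite ltr_pdivrMr// mulrC -ltr_pdivrMr//; exact: lt_le_trans m4.
Qed.

Section local_path.
Context {R : realType} {X : completeMetricType R}.
Implicit Types (a b x y : X) (r c e s t : R).

Lemma complete_limit (u : nat -> X) (r : R) : 0 <= r ->
  (forall m j, mdist (u m) (u (m + j)%N) <= r / 4 ^+ m) ->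
  exists l, forall m, mdist (u m) l <= r / 4 ^+ m.
Proof.
move=> r0 ur.
have : cauchy (u @ \oo).
  apply: cauchy_exP => e /= e0; have [m me] := geometric_small r0 e0.
  exists (u m); exists m => // n /= mn.
  by rewrite ballEmdist /= -(subnKC mn); apply: le_lt_trans (ur _ _) me.
move=> /cauchy_cvgP /cvg_ex[l ul]; exists l => m.
apply/ler_addgt0Pr => e e0.
have [n _ un] : \forall n \near \oo, ball l e (u n).
  by apply: ul; exact: nbhsx_ballx.
have := un (m + n)%N (leq_addl _ _); rewrite ballEmdist /= metric_sym => ule.
apply: (le_trans (metric_triangle _ (u (m + n)%N) _)).
by rewrite lerD// ltW.
Qed.

Lemma bounded_min_radius (P : nat -> R -> Prop) n :
  (forall i d d', 0 < d' -> d' <= d -> P i d -> P i d') ->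
  (forall i, (i < n)%N -> exists2 d, 0 < d & P i d) ->
  exists2 d, 0 < d & forall i, (i < n)%N -> P i d.
Proof.
move=> Pmono; elim: n => [|n IH] H; first by exists 1.
have [|d d0 dP] := IH; first by move=> i /ltnW; exact: H.
have [d' d'0 d'P] := H n (ltnSn n).
have m0 : 0 < Num.min d d' by rewrite lt_min d0.
exists (Num.min d d') => // i; rewrite ltnS leq_eqVlt => /predU1P[->|/dP Pi].
  by apply: Pmono d'P => //; rewrite ge_min lexx orbT.
by apply: Pmono Pi => //; rewrite ge_min lexx.
Qed.

Variables (r c : R).
Hypotheses (r0 : 0 < r) (c1 : 1 <= c).
Let rho n := r / 4 ^+ n.
Let delta n := rho n / c.

(** Refinement data: the steps of a chain at scale [n] are shorter than [delta n.+1], so each of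
    them can be refined again at the next scale. *)
Variables (N : nat -> X -> X -> nat) (z : nat -> X -> X -> nat -> X).
Hypothesis NzP : forall n a b, mdist a b < delta n ->
  [/\ (0 < N n a b)%N, z n a b 0%N = a, z n a b (N n a b) = b,
    forall i, (i <= N n a b)%N -> mdist a (z n a b i) < rho n &
    forall i, (i < N n a b)%N ->
      mdist (z n a b i) (z n a b i.+1) < delta n.+1].

Let c0 : 0 < c. Proof. by move: c1; lra. Qed.

Let rho0 n : 0 < rho n.
Proof. by rewrite divr_gt0// exprn_gt0. Qed.

Let rhoS n : rho n.+1 = rho n / 4.
Proof. by rewrite /rho exprSr invfM mulrA. Qed.

Let delta_rho n : delta n <= rho n.
Proof. by rewrite ler_pdivrMr// ler_peMr// ltW. Qed.

(** The index of the piece containing [t] when [[0, 1]] is cut into [n] equal pieces; the minimum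
    puts [t = 1] into the last piece. *)
Let idx n (t : R) := minn (Num.trunc (n%:R * t)) n.-1.

Let idxP n t : (0 < n)%N -> 0 <= t <= 1 ->
  [/\ (idx n t < n)%N, (idx n t)%:R <= n%:R * t & n%:R * t <= (idx n t).+1%:R].
Proof.
move=> n0 /andP[t0 t1].
have nt0 : 0 <= n%:R * t by rewrite mulr_ge0.
have /andP[lo hi] := truncn_itv nt0; rewrite /idx; split.
- by rewrite -[ltnRHS](prednK n0) ltnS geq_minr.
- by apply: le_trans lo; rewrite ler_nat geq_minl.
- rewrite /minn; case: ltnP => _; first exact: ltW.
  by rewrite prednK// ler_piMr.
Qed.

Let idx_mono n s t : s <= t -> (idx n s <= idx n t)%N.
Proof.
move=> st; rewrite leq_min geq_minr andbT.
apply: (leq_trans (geq_minl _ _)); apply: le_truncn.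
by rewrite ler_wpM2l.
Qed.

(* A cell (a, b, t) of depth n is a pair of consecutive points of the n-th
   refinement of a chain, with the relative position t between them. *)
Let cell_next n (q : X * X * R) : X * X * R :=
  let: (a, b, t) := q in let i := idx (N n a b) t in
  (z n a b i, z n a b i.+1, (N n a b)%:R * t - i%:R).

Let valid n (q : X * X * R) := mdist q.1.1 q.1.2 < delta n /\ 0 <= q.2 <= 1.

Let validS n q : valid n q -> valid n.+1 (cell_next n q).
Proof.
case: q => -[a b] t [/= ab t01]; have [N0 _ _ _ zd] := NzP ab.
have [iN lo hi] := idxP N0 t01; split=> /=; first exact: zd.
by rewrite subr_ge0 lo /= lerBlDr -natr1 addrC in hi *.
Qed.

Fixpoint cell_iter m n q :=
  if m is m'.+1 then cell_iter m' n.+1 (cell_next n q) else q.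

Let cell_iterD m j n q :
  cell_iter (m + j) n q = cell_iter j (n + m) (cell_iter m n q).
Proof.
elim: m n q => [|m IH] n q /=; first by rewrite addn0.
by rewrite IH addSnnS.
Qed.

Let valid_iter m n q : valid n q -> valid (n + m) (cell_iter m n q).
Proof.
elim: m n q => [|m IH] n q vq /=; first by rewrite addn0.
by rewrite -addSnnS; apply: IH; exact: validS.
Qed.

(** Geometric series: one refinement moves the first point by less than [rho n], the later ones by
    at most [2 * rho n.+1], which is [rho n / 2]. *)
Let cell_iter_dist m n q : valid n q ->
  mdist q.1.1 (cell_iter m n q).1.1 <= 2 * rho n.
Proof.
elim: m n q => [|m IH] n q vq /=.
  by rewrite mdistxx mulr_ge0// ltW.
have := IH _ _ (validS vq); set q' := cell_iter _ _ _ => h.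
have h1 : mdist q.1.1 (cell_next n q).1.1 < rho n.
  case: q vq {h q'} => -[a b] t [/= ab t01]; have [N0 _ _ zd _] := NzP ab.
  by have [iN _ _] := idxP N0 t01; apply: zd; exact: ltnW.
have := metric_triangle q.1.1 (cell_next n q).1.1 q'.1.1.
have := rho0 n; rewrite rhoS in h; lra.
Qed.

(** Validity stands inside the existential so that the limit [L] becomes a total function. *)
Let limit_ex n q : exists l, valid n q ->
  forall m, mdist (cell_iter m n q).1.1 l <= 2 * rho (n + m).
Proof.
have [vq|nvq] := pselect (valid n q); last by exists q.1.1.
have E m : 2 * rho (n + m) = 2 * rho n / 4 ^+ m.
  by rewrite /rho exprD invfM !mulrA.
have [|m j|l lP] := @complete_limit (fun m => (cell_iter m n q).1.1) (2 * rho n).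
- by rewrite mulr_ge0// ltW.
- by rewrite -E cell_iterD; exact/cell_iter_dist/valid_iter.
- by exists l => _ m; rewrite E.
Qed.

Let L n q := sval (cid (limit_ex n q)).

Let LP n q m : valid n q -> mdist (cell_iter m n q).1.1 (L n q) <= 2 * rho (n + m).
Proof. by move=> vq; rewrite /L; case: cid => /= l; apply. Qed.

Let small_eq x y n (k : R) : 0 <= k ->
  (forall m, mdist x y <= k * rho (n + m)) -> x = y.
Proof.
move=> k0 H; apply: mdist_positivity; apply/eqP; rewrite eq_le mdist_ge0 andbT.
apply/ler_addgt0Pr => e e0; rewrite add0r.
have [m me] := @geometric_small R (k * rho n) e (mulr_ge0 k0 (ltW (rho0 n))) e0.
apply: le_trans (H m) _; apply: le_trans (ltW me).
by rewrite /rho exprD invfM !mulrA.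
Qed.

(** Both sides are limits of the same sequence of cells, the right one started a refinement
    later. *)
Let LS n q : valid n q -> L n q = L n.+1 (cell_next n q).
Proof.
move=> vq; apply: (@small_eq _ _ n 4) => // m.
have h1 := LP m.+1 vq; have h2 := LP m (validS vq).
have := metric_triangle (L n q) (cell_iter m.+1 n q).1.1 (L n.+1 (cell_next n q)).
rewrite metric_sym in h1; rewrite /= addnS addSn rhoS in h1 h2 *.
have := rho0 (n + m); lra.
Qed.

Let L_src n q : valid n q -> mdist q.1.1 (L n q) <= 2 * rho n.
Proof. by move=> vq; have := LP 0 vq; rewrite addn0. Qed.

Let gam n a b t := L n (a, b, t).

(** Uniform continuity at scale [k], with a sharper bound near the two ends: passing from a cell to
    its neighbour costs [4 * k + 4 * k]. *)
Let modulus n a b (k d : R) := [/\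
  forall s t, 0 <= s -> s <= t -> t <= 1 -> t - s < d ->
    mdist (gam n a b s) (gam n a b t) <= 8 * k,
  forall t, 0 <= t <= 1 -> t < d -> mdist (gam n a b t) a <= 4 * k &
  forall t, 0 <= t <= 1 -> 1 - t < d -> mdist (gam n a b t) b <= 4 * k].

(** Induction on the number of refinements: the finitely many pieces of the first refinement have a
    common modulus at the finer scale, and close parameters lie in the same piece or in adjacent
    ones. *)
Let gam_modulus m n a b : mdist a b < delta n ->
  exists2 d, 0 < d & modulus n a b (rho (n + m)) d.
Proof.
elim: m n a b => [|m IH] n a b ab.
  have H t : 0 <= t <= 1 -> mdist a (gam n a b t) <= 2 * rho n.
    by move=> t01; exact: (@L_src n (a, b, t)).
  have h0 := rho0 n; have h1 := delta_rho n.
  exists 1 => //; rewrite addn0; split.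
  - move=> s t s0 st t1 _; have hs : 0 <= s <= 1 by lra.
    have ht : 0 <= t <= 1 by lra.
    have := H _ hs; have := H _ ht; rewrite (metric_sym a (gam n a b s)).
    by have := metric_triangle (gam n a b s) a (gam n a b t); lra.
  - by move=> t /H; rewrite metric_sym; lra.
  - move=> t /H + _; rewrite metric_sym.
    by have := metric_triangle (gam n a b t) a b; lra.
have [N0 z0 zN zr zd] := NzP ab.
set M := N n a b in N0 zN zr zd; set w := z n a b in z0 zN zr zd.
have gamS t : 0 <= t <= 1 -> let i := idx M t in
    gam n a b t = gam n.+1 (w i) (w i.+1) (M%:R * t - i%:R).
  by move=> t01; rewrite /gam LS.
have [d d0 dP] : exists2 d, 0 < d & forall i, (i < M)%N ->
    modulus n.+1 (w i) (w i.+1) (rho (n + m.+1)) d.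
  apply: bounded_min_radius => [i d d' d'0 d'd [h1 h2 h3]|i iM]; last first.
    by rewrite addnS -addSn; exact/IH/zd.
  by split=> [s t ? ? ? ?|t ? ?|t ? ?]; [apply: h1|apply: h2|apply: h3] => //; lra.
have M0 : 0 < M%:R :> R by rewrite ltr0n.
(* The parameter is stretched by [M] when passing to a piece; the bound [1] prevents skipping a
   whole piece. *)
exists (Num.min d 1 / M%:R); first by rewrite divr_gt0// lt_min d0 ltr01.
split.
- move=> s t s0 st t1; rewrite ltr_pdivlMr// lt_min mulrC => /andP[std st1].
  have s01 : 0 <= s <= 1 by lra.
  have t01 : 0 <= t <= 1 by lra.
  have [iM ilo ihi] := idxP N0 s01; have [jM jlo jhi] := idxP N0 t01.
  rewrite (gamS _ s01) (gamS _ t01).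
  have := idx_mono M st; move: ilo ihi jlo jhi iM jM.
  move: (idx M s) (idx M t) => i j ilo ihi jlo jhi iM jM ij.
  rewrite mulrBr in std st1; rewrite -natr1 in ihi; rewrite -natr1 in jhi.
  move: ilo ihi jlo jhi std st1; have : M%:R * s <= M%:R * t by rewrite ler_pM2l.
  move: (M%:R * s) (M%:R * t) => p q pq ilo ihi jlo jhi std st1.
  have [eij|nij] := eqVneq i j.
    subst j; have [+ _ _] := dP _ iM; apply; lra.
  have eij : j = i.+1.
    apply/eqP; rewrite eqn_leq [X in _ && X]ltn_neqAle nij ij andbT.
    by rewrite -ltnS -(ltr_nat R) -!natr1; lra.
  subst j; rewrite -natr1 in jlo jhi *.
  (* For adjacent pieces, the estimate goes through their common point [w i.+1]. *)
  have [_ _ +] := dP _ iM => /(_ (p - i%:R)) h1.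
  have [_ + _] := dP _ jM => /(_ (q - (i%:R + 1))) h2.
  have {}h1 := h1 ltac:(lra) ltac:(lra).
  have {}h2 := h2 ltac:(lra) ltac:(lra).
  rewrite metric_sym in h2.
  apply: (le_trans (metric_triangle _ (w i.+1) _)); lra.
- move=> t t01; rewrite ltr_pdivlMr// lt_min mulrC => /andP[td t1].
  rewrite (gamS _ t01); have [iM ilo ihi] := idxP N0 t01.
  have i0 : idx M t = 0%N.
    by apply/eqP; rewrite -leqn0 -ltnS -(ltr_nat R) (le_lt_trans ilo t1).
  rewrite i0 in ilo ihi *; have [_ + _] := dP _ N0.
  by rewrite z0; apply; lra.
- move=> t t01; rewrite ltr_pdivlMr// lt_min mulrC mulrBr mulr1 => /andP[td t1].
  rewrite (gamS _ t01); have [iM ilo ihi] := idxP N0 t01.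
  have iE : (idx M t).+1 = M.
    apply/eqP; rewrite eqn_leq iM -ltnS -(ltr_nat R) /=.
    by rewrite -!natr1 in ihi *; lra.
  have [_ _ +] := dP _ iM; rewrite iE zN; apply; rewrite -[M in M%:R * t]iE.
    rewrite -natr1 in ihi; rewrite iE; lra.
  rewrite iE; have -> : (idx M t)%:R = M%:R - 1 :> R by rewrite -[in RHS]iE -natr1 addrK.
  lra.
Qed.

(** The moduli at all depths give continuity, and they also fix the endpoints, whose distances to
    [a] and [b] are at most [4 * rho m] for every [m]. *)
Lemma refinement_path a b : mdist a b < r / c -> exists g : R -> X,
  [/\ path01 g, g 0 = a, g 1 = b &
    forall t, 0 <= t <= 1 -> mdist a (g t) <= 2 * r].
Proof.
move=> ab'.
have rho_0 : rho 0 = r by rewrite /rho expr0 divr1.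
have ab : mdist a b < delta 0 by rewrite /delta rho_0.
exists (gam 0 a b); split.
- move=> t t01 e e0.
  have r8 : 0 <= 8 * r by rewrite mulr_ge0// ltW.
  have [m me] := geometric_small r8 e0.
  have [d d0 [H _ _]] := gam_modulus m ab; exists d => // s s01 std.
  have {}me : 8 * rho (0 + m) < e by rewrite add0n /rho mulrA.
  apply: le_lt_trans me; move: std.
  case/orP: (le_total s t) => st.
    by rewrite distrC ger0_norm ?subr_ge0// metric_sym => std; apply: H; lra.
  by rewrite ger0_norm ?subr_ge0// => std; apply: H; lra.
- apply: (@small_eq _ _ 0 4) => // m.
  by have [d d0 [_ + _]] := gam_modulus m ab; apply; lra.
- apply: (@small_eq _ _ 0 4) => // m.
  by have [d d0 [_ _ +]] := gam_modulus m ab; apply; lra.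
- by move=> t t01; have := @L_src 0 (a, b, t); rewrite rho_0; apply.
Qed.

End local_path.

(** * Concatenation of curves and path connectedness of open sets *)

Section paths.
Context {R : realType} {X : completeMetricType R}.
Implicit Types (a b x y : X) (U : set X) (r c e s t u v : R) (g : R -> X).

(** By [component_ball], the point [b'] lies in the component of [a'] in the ball of radius
    [r / 4 ^+ n]; a fine chain in this connected set supplies the refinement. *)
Lemma local_path c r a b : 1 <= c -> @ball_splitting R X c -> 0 < r ->
  mdist a b < r / c -> exists g : R -> X,
  [/\ path01 g, g 0 = a, g 1 = b &
    forall t, 0 <= t <= 1 -> mdist a (g t) <= 2 * r].
Proof.
move=> c1 bs r0 ab; have c0 : 0 < c by lra.
have chain (q : nat * X * X) : exists Nz : nat * (nat -> X),
    let: (n, a, b) := q in mdist a b < r / 4 ^+ n / c ->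
    [/\ (0 < Nz.1)%N, Nz.2 0%N = a, Nz.2 Nz.1 = b,
      forall i, (i <= Nz.1)%N -> mdist a (Nz.2 i) < r / 4 ^+ n &
      forall i, (i < Nz.1)%N ->
        mdist (Nz.2 i) (Nz.2 i.+1) < r / 4 ^+ n.+1 / c].
  case: q => -[n a'] b'.
  have [ab'|nab'] := pselect (mdist a' b' < r / 4 ^+ n / c); last first.
    (* Default value for points too far apart, about which nothing is claimed. *)
    by exists (0%N, fun=> a').
  have r4 k : 0 < r / 4 ^+ k by rewrite divr_gt0// exprn_gt0.
  have C := @component_connected X (ball a' (r / 4 ^+ n)) a'.
  have Cb : connected_component (ball a' (r / 4 ^+ n)) a' b'.
    apply: (component_ball c0 bs (mball_open _ _) (r4 n)) => //.
    by rewrite ballEmdist.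
  have Ca := @connected_component_refl X _ a' (ballxx a' (r4 n)).
  have e0 : 0 < r / 4 ^+ n.+1 / c by rewrite divr_gt0.
  have [N [z [z0 zN zC ze]]] := connected_chain C Ca Cb e0.
  (* The last point is repeated so that the number of steps is positive even when [N] is [0]. *)
  exists (N.+1, fun i => if (i <= N)%N then z i else b') => _ /=.
  rewrite ltnn; split=> // i.
    move=> _; case: ifPn => [/zC/connected_component_sub|_].
      by rewrite ballEmdist.
    by move/connected_component_sub: Cb; rewrite ballEmdist.
  rewrite ltnS => iN; rewrite iN; case: ltnP => [|Ni]; first exact: ze.
  have -> : i = N by apply/eqP; rewrite eqn_leq iN.
  by rewrite zN mdistxx.
have [F FP] := choice chain.
apply: (@refinement_path R X r c r0 c1 (fun n a b => (F (n, a, b)).1)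
  (fun n a b => (F (n, a, b)).2)) => // n a' b'.
exact: (FP (n, a', b')).
Qed.

Definition paste (p : nat -> R -> X) u :=
  p (Num.trunc u) (u - (Num.trunc u)%:R).

(** Only integers need care: points just to the left of one belong to the previous curve, which ends
    where the next begins. The radius [d1] serves the curve of [u], and [d2] the points left of
    [j]. *)
Lemma paste_continuous (p : nat -> R -> X) :
  (forall j, path01 (p j)) -> (forall j, p j 1 = p j.+1 0) ->
  forall u, 0 <= u -> forall e, 0 < e -> exists2 d, 0 < d &
    forall v, 0 <= v -> `|v - u| < d -> mdist (paste p u) (paste p v) < e.
Proof.
move=> pc pj u u0 e e0; set j := Num.trunc u.
have /andP[ju uj] : j%:R <= u < j.+1%:R by exact: truncn_itv.
have uj01 : 0 <= u - j%:R <= 1 by rewrite -natr1 in uj; lra.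
have [d1 d10 H1] := pc j _ uj01 _ e0.
have [d2 d20 H2] : exists2 d, 0 < d & forall v, 0 <= v -> v < j%:R ->
    `|v - u| < d -> mdist (paste p u) (paste p v) < e.
  have [{}ju|uj'] := ltP j%:R u.
    exists (u - j%:R); first by rewrite subr_gt0.
    by move=> v v0 vj; rewrite ltr0_norm ?subr_lt0; lra.
  have uE : u = j%:R by apply/eqP; rewrite eq_le uj'.
  rewrite /paste -/j uE subrr; clear ju uj' uj uj01 H1.
  case: j uE => [|i] uE; first by exists 1 => // v v0; rewrite ltNge v0.
  have one01 : 0 <= (1 : R) <= 1 by rewrite ler01 lexx.
  have [d2 d20 H2] := pc i 1 one01 _ e0.
  exists (Num.min d2 1); first by rewrite lt_min d20 ltr01.
  move=> v v0 vi; rewrite -pj lt_min -natr1 => /andP[vd vd1].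
  have iv : i%:R <= v by move: vd1; rewrite ltr_norml; lra.
  have -> : Num.trunc v = i by apply: truncn_def; rewrite iv.
  rewrite -natr1 in vi.
  apply: H2; first lra.
  by rewrite [X in `|X|](_ : _ = v - (i%:R + 1)) //; lra.
exists (Num.min d1 (Num.min d2 (j.+1%:R - u))).
  by rewrite !lt_min d10 d20 subr_gt0.
move=> v v0; rewrite !lt_min => /and3P[vd1 vd2 vd3].
have [vj|jv] := ltP v j%:R; first exact: H2.
have vj : v < j.+1%:R by move: vd3; rewrite ltr_norml; lra.
rewrite /paste -/j (_ : Num.trunc v = j); last by apply: truncn_def; rewrite jv.
rewrite -natr1 in vj; apply: H1; first lra.
by rewrite [X in `|X|](_ : _ = v - u) //; lra.
Qed.

Definition joined U a b := exists g : R -> X,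
  [/\ path01 g, g 0 = a, g 1 = b & forall t, 0 <= t <= 1 -> U (g t)].

Lemma joined_refl U a : U a -> joined U a a.
Proof.
move=> Ua; exists (fun=> a); split=> // t _ e e0.
by exists 1 => // s _ _; rewrite mdistxx.
Qed.

Lemma path01_cst a : path01 (fun _ : R => a).
Proof.
by move=> t _ e e0; exists 1 => // s _ _; rewrite mdistxx.
Qed.

Lemma joined_trans U b a x : joined U a b -> joined U b x -> joined U a x.
Proof.
move=> [g1 [g1c g10 g11 g1U]] [g2 [g2c g20 g21 g2U]].
(* At [t = 1] the pasted curve has index [2], hence the constant curves at [x]. *)
pose p j := if j is 0%N then g1 else if j is 1%N then g2 else fun=> x.
have pc j : path01 (p j) by case: j => [|[|j]] //; exact: path01_cst.
have pj j : p j 1 = p j.+1 0.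
  by case: j => [|[|j]] //=; rewrite g11 g20.
exists (fun t => paste p (2 * t)); split.
- move=> t /andP[t0 t1] e e0.
  have t20 : 0 <= 2 * t by lra.
  have [d d0 H] := paste_continuous pc pj t20 e0.
  exists (d / 2); first lra.
  move=> s /andP[s0 s1] st; apply: H; first lra.
  by rewrite -mulrBr normrM ger0_norm//; lra.
- by rewrite mulr0 /paste truncn0 subr0.
- by rewrite mulr1 /paste natrK subrr.
- move=> t /andP[t0 t1]; have t20 : 0 <= 2 * t by lra.
  have := truncn_itv t20; rewrite /paste; case: (Num.trunc _) => [|[|j]] /=.
  + by move=> h; apply: g1U; lra.
  + by move=> h; apply: g2U; lra.
  + by move=> _; rewrite -g21; apply: g2U; rewrite ler01 lexx.
Qed.

(** The points of [U] joined to [a] and the remaining ones both form open sets, because nearby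
    points are joined inside [U]. *)
Lemma open_connected_joined k U a b : 1 <= k -> @ball_splitting R X k ->
  open U -> connected U -> U a -> U b -> joined U a b.
Proof.
move=> k1 bs oU cU Ua Ub.
(* Applying [local_path] from [y] and from [z] gives both directions without reversing a curve. With
   radius [r / 4], a curve from [z] stays within [r / 4 + r / 2] of [y]. *)
have near y : U y -> exists2 d, 0 < d & forall z, ball y d z ->
    [/\ U z, joined U y z & joined U z y].
  move=> Uy; have /open_ballP/(_ _ Uy)[r r0 rU] := oU.
  have k0 : 0 < k by lra.
  have r4 : 0 < r / 4 by lra.
  have d0 : 0 < r / 4 / k by rewrite divr_gt0.
  have dr : r / 4 / k <= r / 4 by rewrite ler_pdivrMr// ler_peMr// ltW.
  exists (r / 4 / k) => // z; rewrite ballEmdist /= => yz; split.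
  - by apply: rU; rewrite ballEmdist /=; lra.
  - have [g [gc g0 g1 gr]] := local_path k1 bs r4 yz; exists g; split=> // t t01.
    by apply: rU; rewrite ballEmdist /=; have := gr _ t01; lra.
  - rewrite metric_sym in yz.
    have [g [gc g0 g1 gr]] := local_path k1 bs r4 yz; exists g; split=> // t t01.
    apply: rU; rewrite ballEmdist /=; have := gr _ t01.
    have := metric_triangle y z (g t); rewrite (metric_sym y z); lra.
pose V := [set y | U y /\ joined U a y].
pose W := [set y | U y /\ ~ joined U a y].
suff : U `<=` V by move=> /(_ _ Ub)[].
apply: (@connected_clopen _ _ U V W) => //.
- apply/open_ballP => y [Uy ay]; have [d d0 H] := near _ Uy.
  by exists d => // z /H[Uz yz _]; split=> //; exact: joined_trans ay yz.
- apply/open_ballP => y [Uy ay]; have [d d0 H] := near _ Uy.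
  exists d => // z /H[Uz _ zy]; split=> // az.
  by apply: ay; exact: joined_trans az zy.
- by rewrite -subset0 => y [[_ [_ ?]] [_ ?]].
- by move=> y Uy; have [?|?] := pselect (joined U a y); [left|right].
- by exists a; split=> //; split=> //; exact: joined_refl.
Qed.

End paths.

(** * Compactness from doubling *)

Lemma open_measurable_borel {R : realType} {X : pointedMetricType R}
  (A : set X) : open A -> measurable (A : set (borel X)).
Proof. by move=> oA; exact: sub_sigma_algebra. Qed.

Section doubling_compactness.
Context {R : realType} {X : completeMetricType R}.
Variable mu : {measure set (borel X) -> \bar R}.
Hypotheses (hmu : balls_pos_finite mu) (hdoubling : doubling mu).
Implicit Types (x y z : X) (A B : set X) (r e : R).

Let mball x r : measurable (ball x r : set (borel X)).
Proof. by apply: open_measurable_borel; exact: mball_open. Qed.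

Lemma doubling_iter : exists2 C : R, 0 < C & forall k x r, 0 < r ->
  (mu (ball x (2 ^+ k * r)) <= (C ^+ k)%:E * mu (ball x r))%E.
Proof.
have [C C0 HC] := hdoubling; exists C => //; elim=> [|k IH] x r r0.
  by rewrite !expr0 mul1r mul1e.
have r' : 0 < 2 ^+ k * r by rewrite mulr_gt0// exprn_gt0.
rewrite !exprS -mulrA; apply: (le_trans (HC x _ r')).
rewrite EFinM -muleA; apply: lee_wpmul2l; last exact: IH.
by rewrite lee_fin ltW.
Qed.

(** As [2 * r < 2 ^+ k * e], the ball of radius [2 ^+ k * e] about [y] contains [ball x r], and
    iterated doubling compares it with [ball y e]. *)
Lemma balls_measure_lb x r e : 0 < r -> 0 < e -> exists2 m : R, 0 < m &
  forall y, ball x r y -> (m%:E <= mu (ball y e))%E.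
Proof.
move=> r0 e0; have [C C0 HC] := doubling_iter.
pose k := (Num.trunc (2 * r / e)).+1.
have ke : 2 * r < 2 ^+ k * e.
  rewrite -ltr_pdivrMr//; apply: lt_le_trans (truncnS_gt _) _.
  by rewrite -natrX ler_nat ltnW// ltn_expl.
have /andP[mx0 mxoo] := hmu x r0.
have mE : mu (ball x r) = (fine (mu (ball x r)))%:E.
  by rewrite fineK// ge0_fin_numE.
have Ck : 0 < C ^+ k by rewrite exprn_gt0.
have m0 : 0 < fine (mu (ball x r)) by rewrite -lte_fin -mE.
exists (fine (mu (ball x r)) / C ^+ k); first by rewrite divr_gt0.
move=> y xy; rewrite [X in (X%:E <= _)%E]mulrC EFinM -[X in (_ * X <= _)%E]mE lee_pdivrMl//.
apply: le_trans (HC k y e e0); apply: le_measure; rewrite ?inE//.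
move=> w; move: xy; rewrite !ballEmdist /= => xy xw.
have := metric_triangle y x w; rewrite (metric_sym y x); lra.
Qed.

(** The balls of radius [e / 2] about the points are disjoint, lie in [ball x (r + e)] and have
    measure at least [m]. *)
Lemma separated_size x r e : 0 < r -> 0 < e -> exists n, forall s : seq X,
  (forall y, y \in s -> ball x r y) ->
  pairwise (fun y z => e <= mdist y z) s -> (size s <= n)%N.
Proof.
move=> r0 e0; have e20 : 0 < e / 2 by lra.
have [m m0 Hm] := balls_measure_lb x r0 e20.
have re : 0 < r + e by lra.
have /andP[M0 Moo] := hmu x re.
have ME : mu (ball x (r + e)) = (fine (mu (ball x (r + e))))%:E.
  by rewrite fineK// ge0_fin_numE.
exists (Num.trunc (fine (mu (ball x (r + e))) / m)) => s sx sep.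
pose U (s : seq X) : set X := \bigcup_(y in [set` s]) ball y (e / 2).
have mU s' : measurable (U s' : set (borel X)).
  by apply: open_measurable_borel; apply: bigcup_open => y _; exact: mball_open.
have H : forall s' : seq X, (forall y, y \in s' -> ball x r y) ->
    pairwise (fun y z => e <= mdist y z) s' ->
    (((size s')%:R * m)%:E <= mu (U s'))%E.
  elim=> [|y s' IH] s'x; first by rewrite mul0r.
  rewrite /= => /andP[ys' ss'].
  have UE : U (y :: s') = ball y (e / 2) `|` U s'.
    apply/seteqP; split=> w.
      move=> [v /=]; rewrite inE => /orP[/eqP -> ?|vs vw]; [by left|right].
      by exists v.
    move=> [yw|[v /= vs vw]]; first by exists y => //=; rewrite inE eqxx.
    by exists v => //=; rewrite inE vs orbT.
  rewrite UE measureU//.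
    rewrite -natr1 mulrDl mul1r addrC EFinD; apply: leeD.
      by apply: Hm; apply: s'x; rewrite inE eqxx.
    by apply: IH => // v vs; apply: s'x; rewrite inE vs orbT.
  rewrite -subset0 => w [] + [v /= vs].
  rewrite !ballEmdist /= => yw vw.
  move/allP : ys' => /(_ _ vs) yv.
  by have := metric_triangle y w v; rewrite (metric_sym w v); lra.
rewrite truncn_ge_nat; last by rewrite divr_ge0// ltW.
rewrite ler_pdivlMr// -lee_fin -ME; apply: le_trans (H s sx sep) _.
apply: le_measure; rewrite ?inE//; move=> w [v /= /sx].
rewrite !ballEmdist /= => xv vw; have := metric_triangle x v w; lra.
Qed.

(** Without a finite cover, [e]-separated lists could be extended beyond the bound of
    [separated_size]. *)
Lemma totally_bounded_cover A e : metric_bounded A -> 0 < e ->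
  exists s : seq X, A `<=` \bigcup_(y in [set` s]) ball y e.
Proof.
move=> [x [r0 Ar0]] e0; pose r := Num.max r0 1.
have r1 : 0 < r by rewrite lt_max ltr01 orbT.
have Ar : A `<=` ball x r.
  move=> y /Ar0; rewrite !ballEmdist /= => h.
  by rewrite lt_max h.
have [n Hn] := separated_size x r1 e0.
apply: contrapT => /forallNP ncover.
have : forall k, exists s : seq X, [/\ size s = k, forall y, y \in s -> A y &
    pairwise (fun y z => e <= mdist y z) s].
  elim=> [|k [s [sk sA ss]]]; first by exists [::].
  have /existsNP[y /not_implyP[Ay nys]] := ncover s.
  exists (y :: s); split=> /=; first by rewrite sk.
  - by move=> z; rewrite inE => /orP[/eqP ->|/sA].
  - rewrite ss andbT; apply/allP => z zs; rewrite leNgt; apply/negP => yz.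
    by apply: nys; exists z => //; rewrite ballEmdist /= metric_sym.
move=> /(_ n.+1)[s [sn sA ss]].
by have := Hn s (fun y ys => Ar _ (sA _ ys)) ss; rewrite sn ltnn.
Qed.

(** Otherwise an ultrafilter contains every [E k] minus the ball. Total boundedness makes it Cauchy;
    its limit lies in all closures, so it is [x], yet the ultrafilter avoids a ball about [x]. *)
Lemma nested_shrink (E : nat -> set X) x e : metric_bounded (E 0%N) ->
  (forall k, E k.+1 `<=` E k) -> \bigcap_k closure (E k) = [set x] -> 0 < e ->
  exists k, E k `<=` ball x e.
Proof.
move=> bE E_dec Ex e0; apply: contrapT => /forallNP nE.
have Emono k j : (k <= j)%N -> E j `<=` E k.
  move=> /subnKC <-; elim: (j - k)%N => [|i IH]; first by rewrite addn0.
  by rewrite addnS; apply: subset_trans IH; exact: E_dec.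
pose F : set_system X := [set A | exists k, E k `\` ball x e `<=` A].
have FF : ProperFilter F.
  apply: Build_ProperFilter.
    move=> [k Ek]; apply: (nE k) => y Ey; apply: contrapT => nxy.
    by have := Ek y (conj Ey nxy).
  split.
  - by exists 0%N.
  - move=> A B [k kA] [j jB]; exists (maxn k j) => y [Ey nxy]; split.
      by apply: kA; split=> //; apply: Emono Ey; exact: leq_maxl.
    by apply: jB; split=> //; apply: Emono Ey; exact: leq_maxr.
  - by move=> A B AB [k kA]; exists k; exact: subset_trans AB.
have [G [GU FG]] := ultraFilterLemma FF.
have GF : ProperFilter G by exact: ultra_proper.
have FE k : G (E k `\` ball x e) by apply: FG; exists k.
have : cauchy G.
  apply: cauchy_exP => d /= d0.
  have [s Es] := totally_bounded_cover bE d0.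
  have {Es} : G (\bigcup_(y in [set` s]) ball y d).
    by apply: filterS (FE 0%N) => y [/Es].
  elim: s => [|y s IH].
    rewrite (_ : \bigcup_(y in _) _ = set0); last first.
      by rewrite -subset0 => y [z].
    by move=> /(@filter_not_empty _ G _).
  (* The ultrafilter picks one ball of the finite cover. *)
  move=> Gs; have [Gy|nGy] := in_ultra_setVsetC (ball y d) GU; first by exists y.
  apply: IH; apply: filterS (filterI Gs nGy) => w [[z /=]].
  by rewrite inE => /orP[/eqP -> //|zs zw _]; exists z.
move=> /cauchy_cvgP /cvg_ex[l Gl].
have lE k A : nbhs l A -> (E k `\` ball x e) `&` A !=set0.
  by move=> /Gl GA; exact: (@filter_ex _ G _ _ (filterI (FE k) GA)).
have : (\bigcap_k closure (E k)) l.
  by move=> k _ A /(lE k)[y [[Ey _] Ay]]; exists y.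
rewrite Ex => lx; have [y [[_ nxy] xy]] := lE 0%N (ball l e) (nbhsx_ballx _ _ e0).
by apply: nxy; rewrite -lx.
Qed.

End doubling_compactness.

(** * Poincare inequality and connectivity *)

Section profile.
Context {R : realType}.
Implicit Types (e a b h : R).

(** For [e > 0], the tent lives on [[4e, 8e]] with peak [2e] at [6e], and the ramp falls from [2e]
    to [0] over [[5e, 7e]]; the margins of width [e] absorb increments. *)
Definition tent e a : R := Num.max 0 (Num.min (a - 4 * e) (8 * e - a)).
Definition ramp e a : R := Num.max 0 (Num.min (2 * e) (7 * e - a)).

Variant tent_spec e a : R -> Prop :=
| Tent0 of a - 4 * e <= 0 \/ 8 * e - a <= 0 : tent_spec e a 0
| TentUp of 0 <= a - 4 * e & a - 4 * e <= 8 * e - a : tent_spec e a (a - 4 * e)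
| TentDown of 0 <= 8 * e - a & 8 * e - a <= a - 4 * e :
    tent_spec e a (8 * e - a).

Lemma tentP e a : tent_spec e a (tent e a).
Proof.
rewrite /tent; case: (leP (a - 4 * e) (8 * e - a)) => h1.
  by case: (leP 0 (a - 4 * e)) => h2; constructor; lra.
by case: (leP 0 (8 * e - a)) => h2; constructor; lra.
Qed.

Variant ramp_spec e a : R -> Prop :=
| Ramp0 of 2 * e <= 0 \/ 7 * e <= a : ramp_spec e a 0
| RampTop of 0 <= e & a <= 5 * e : ramp_spec e a (2 * e)
| RampDown of 5 * e <= a & a <= 7 * e : ramp_spec e a (7 * e - a).

Lemma rampP e a : ramp_spec e a (ramp e a).
Proof.
rewrite /ramp; case: (leP (2 * e) (7 * e - a)) => h1.
  by case: (leP 0 (2 * e)) => h2; constructor; lra.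
by case: (leP 0 (7 * e - a)) => h2; constructor; lra.
Qed.

Lemma tent_ge0 e a : 0 <= tent e a.
Proof. by rewrite /tent le_max lexx. Qed.

Lemma tent_lipschitz e a b h : `|a - b| <= h -> `|tent e a - tent e b| <= h.
Proof.
rewrite !ler_norml => /andP[h1 h2].
by case: tentP => [[]|?|?] ?; case: tentP => [[]|?|?] ?; lra.
Qed.

Lemma ramp_lipschitz e a b h : 0 <= e ->
  `|a - b| <= h -> `|ramp e a - ramp e b| <= h.
Proof.
rewrite !ler_norml => e0 /andP[h1 h2].
by case: rampP => [[]|?|?] ?; case: rampP => [[]|?|?] ?; lra.
Qed.

Lemma tent_near e a : a <= 4 * e -> tent e a = 0.
Proof. by move=> h; case: tentP => *; lra. Qed.

Lemma tent_far e a : 8 * e <= a -> tent e a = 0.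
Proof. by move=> h; case: tentP => *; lra. Qed.

Lemma tent_le e a : 0 <= e -> tent e a <= 2 * e.
Proof. by move=> h; case: tentP => *; lra. Qed.

Lemma ramp_ge0 e a : 0 <= ramp e a.
Proof. by rewrite /ramp le_max lexx. Qed.

Lemma ramp_near e a : 0 <= e -> a <= 5 * e -> ramp e a = 2 * e.
Proof. by move=> e0 h; case: rampP => [[]|?|?] *; lra. Qed.

Lemma ramp_far e a : 0 <= e -> 7 * e <= a -> ramp e a = 0.
Proof. by move=> e0 h; case: rampP => *; lra. Qed.

Lemma ramp_le e a : 0 <= e -> ramp e a <= 2 * e.
Proof. by move=> h; case: rampP => *; lra. Qed.

(* The slope of the ramp is -1 on [5e, 7e] and 0 elsewhere, whereas tent / e
   is at least 1 on [5e, 7e]. *)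
Lemma ramp_tent e a b h : 0 < e -> `|a - b| <= h ->
  e * `|ramp e a - ramp e b| <= (tent e a + h) * h.
Proof.
move=> e0 abh; have h0 : 0 <= h by apply: le_trans abh.
have [he|he] := leP e (tent e a + h).
  by apply: ler_pM => //; [exact: ltW|apply: ramp_lipschitz => //; exact: ltW].
(* Now [a] is farther than [h] from [[5e, 7e]], so the ramp does not change between [a] and [b]. *)
have -> : ramp e a = ramp e b; last first.
  by rewrite subrr normr0 mulr0 mulr_ge0// addr_ge0// tent_ge0.
move: abh he; rewrite ler_norml => /andP[h1 h2].
by case: tentP => [[]|?|?] ?; case: rampP => [[]|?|?] ?;
  case: rampP => [[]|?|?] ?; lra.
Qed.

End profile.

(** * An upper gradient for the cut-off indicator of a clopen piece *)

Section curves.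
Context {R : realType} {X : pointedMetricType R}.
Implicit Types (x y : X) (e s t : R).

Lemma lipschitz_continuous (h : X -> R) :
  (forall y z, `|h y - h z| <= mdist y z) -> continuous h.
Proof.
move=> hl y; apply/cvgrPdist_lt => d d0.
apply/nbhs_ballP; exists d => // z; rewrite ballEmdist /= => yz.
exact: le_lt_trans yz.
Qed.

Lemma tent_dist_continuous x e : continuous (fun y => tent e (mdist x y)).
Proof.
apply: lipschitz_continuous => y z; apply: tent_lipschitz.
rewrite ler_norml; have := metric_triangle x y z.
have := metric_triangle x z y; rewrite (metric_sym z y); lra.
Qed.

Lemma ramp_dist_continuous x e : 0 <= e -> continuous (fun y => ramp e (mdist x y)).
Proof.
move=> e0; apply: lipschitz_continuous => y z; apply: ramp_lipschitz => //.
rewrite ler_norml; have := metric_triangle x y z.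
have := metric_triangle x z y; rewrite (metric_sym z y); lra.
Qed.

Lemma continuous_borel (h : X -> R) : continuous h ->
  measurable_fun [set: borel X] (h : borel X -> R).
Proof.
move=> ch; apply: (measurability _ (RGenOInfty.measurableE R)).
move=> _ [_ [a ->] <-]; rewrite setTI; apply: sub_sigma_algebra.
by apply: open_comp => // y _; exact: ch.
Qed.

Variable gamma : arc_curve X.
Let l := arc_len gamma.

(** The chord is the polygonal length of the trivial partition, hence at most the arc length
    [t - s]. *)
Lemma arc_lipschitz s t : 0 <= s -> s <= t -> t <= l ->
  mdist (gamma s) (gamma t) <= t - s.
Proof.
move=> s0; rewrite le_eqVlt => /predU1P[->|st] tl.
  by rewrite mdistxx subrr.
rewrite -lee_fin -(arc_length_param s0 (ltW st) tl).
apply: ereal_sup_ubound; exists [:: t]; first exact: itv_partition1.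
by rewrite /polygonal_length /= big_nat1.
Qed.

Variables (x : X) (e : R) (V W : set X).
Hypotheses (e0 : 0 < e) (oV : open V) (oW : open W) (VW0 : V `&` W = set0)
  (xVW : ball x (8 * e) `<=` V `|` W).

Definition cutoff (y : X) : R := if `[<V y>] then ramp e (mdist x y) else 0.

Let f t := tent e (mdist x (gamma t)).

(** A short arc either stays where the ramp vanishes, or stays in [ball x (8 * e)] and then, being
    connected, lies in [V] or in [W]. In [V] the bound is [ramp_tent], in [W] the cutoff is [0]. *)
Lemma cutoff_increment s t : 0 <= s -> s <= t -> t <= l -> t - s < e / 2 ->
  e * `|cutoff (gamma s) - cutoff (gamma t)| <= (f s + (t - s)) * (t - s).
Proof.
move=> s0 st tl ste.
have lip v : s <= v -> v <= t -> `|mdist x (gamma s) - mdist x (gamma v)| <= v - s.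
  move=> sv vt; rewrite ler_norml.
  have := arc_lipschitz s0 sv (le_trans vt tl).
  have := metric_triangle x (gamma s) (gamma v).
  have := metric_triangle x (gamma v) (gamma s).
  by rewrite (metric_sym (gamma v) (gamma s)); lra.
have Rge0 : 0 <= (f s + (t - s)) * (t - s).
  have ts0 : 0 <= t - s by rewrite subr_ge0.
  exact: mulr_ge0 (addr_ge0 (tent_ge0 _ _) ts0) ts0.
(* The threshold is midway between [7e] and [8e], and the arc is shorter than [e / 2]. *)
have [far|near] := leP (15 / 2 * e) (mdist x (gamma s)).
  have zero v : s <= v -> v <= t -> cutoff (gamma v) = 0.
    move=> sv vt; rewrite /cutoff; case: ifP => // _; apply: (ramp_far (ltW e0)).
    by have := lip v sv vt; rewrite ler_norml; lra.
  by rewrite !zero// subrr normr0 mulr0.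
pose C : set X := gamma @` `[s, t].
have cC : connected C.
  apply: connected_continuous_connected; first exact: segment_connected.
  apply: (continuous_subspaceW _ (@arc_continuous _ _ gamma)) => v /=.
  by rewrite !in_itv /= => /andP[sv vt]; rewrite (le_trans s0 sv) (le_trans vt tl).
have CVW : C `<=` V `|` W.
  move=> _ [v /= + <-]; rewrite in_itv /= => /andP[sv vt]; apply: xVW.
  by rewrite ballEmdist /=; have := lip v sv vt; rewrite ler_norml; lra.
have Cs : C (gamma s) by exists s => //=; rewrite in_itv /= lexx.
have Ct : C (gamma t) by exists t => //=; rewrite in_itv /= lexx st.
have [Vs|Ws] := CVW _ Cs.
  have CV : C `<=` V.
    apply: (@connected_clopen _ _ C V W) => //; last by exists (gamma s).
    by rewrite -setIA VW0 setI0.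
  rewrite /cutoff !asboolT; [|exact: CV..].
  by apply: ramp_tent => //; exact: lip.
have CW : C `<=` W.
  apply: (@connected_clopen _ _ C W V) => //; last by exists (gamma s).
    by rewrite -setIA (setIC W) VW0 setI0.
  by rewrite setUC.
have nV y : W y -> ~ V y by move=> Wy Vy; rewrite -[False]/(set0 y) -VW0.
rewrite /cutoff !asboolF; [|exact/nV/CW..].
by rewrite subrr normr0 mulr0.
Qed.

Let f_meas s : s <= l ->
  measurable_fun (`[0, s] : set R) (fun t => (f t)%:E).
Proof.
move=> sl; apply/measurable_EFinP; apply: subspace_continuous_measurable_fun.
  exact: measurable_itv.
have cg : {within `[0, s], continuous gamma}.
  apply: (continuous_subspaceW _ (@arc_continuous _ _ gamma)) => v /=.
  by rewrite !in_itv /= => /andP[-> vs]; rewrite (le_trans vs sl).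
move=> v; apply: (@continuous_comp (subspace `[0, s]) X R gamma
  (fun y => tent e (mdist x y)) v (cg v)).
exact: tent_dist_continuous.
Qed.

Let mu1 := @lebesgue_measure R.

(** With [h = t - s], the increment is at most [(f s + h) * h], whereas the integral over the new
    piece is at least [(f s - h) * h], as [f] is 1-Lipschitz. *)
Let integral_step s t : 0 <= s -> s <= t -> t <= l -> t - s < e / 2 ->
  (\int[mu1]_(v in `[0%R, s]) (f v)%:E +
    (e * `|cutoff (gamma s) - cutoff (gamma t)|)%:E
  <= \int[mu1]_(v in `[0%R, t]) (f v)%:E + (2 * (t - s) ^+ 2)%:E)%E.
Proof.
move=> s0 st tl ste.
have -> : `[0%R, t]%classic = `[0%R, s]%classic `|` `]s, t]%classic.
  by rewrite -itv_bndbnd_setU// bnd_simp.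
have sub : `]s, t]%classic `<=` `[0%R, t]%classic.
  move=> v /=; rewrite !in_itv /= => /andP[sv ->].
  by rewrite (le_trans s0 (ltW sv)).
have mf : measurable_fun (`]s, t] : set R) (fun t => (f t)%:E).
  by apply: measurable_funS (f_meas tl) => //; exact: measurable_itv.
rewrite ge0_integral_setU//=; last 3 first.
- by rewrite -itv_bndbnd_setU ?bnd_simp//; exact: f_meas.
- by move=> v _; rewrite lee_fin tent_ge0.
- apply/disj_setPS => v /= [].
  by rewrite !in_itv /= => /andP[_ vs] /andP[+ _]; rewrite ltNge vs.
rewrite -[X in (_ <= X)%E]addeA; apply: leeD2l.
apply: (@le_trans _ _ (((f s - (t - s)) * (t - s))%:E + (2 * (t - s) ^+ 2)%:E)%E).
  by rewrite -EFinD lee_fin; have := cutoff_increment s0 st tl ste; lra.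
apply: leeD2r.
pose k := Num.max 0 (f s - (t - s)).
apply: (@le_trans _ _ (\int[mu1]_(v in `]s, t]) (cst k%:E v))%E); last first.
  apply: ge0_le_integral => //=.
  - by move=> v _; rewrite lee_fin /k le_max lexx.
  - move=> v; rewrite in_itv /= => /andP[sv vt].
    rewrite lee_fin /k ge_max tent_ge0 /=.
    have : `|f s - f v| <= v - s.
      apply: tent_lipschitz; rewrite ler_norml.
      have := arc_lipschitz s0 (ltW sv) (le_trans vt tl).
      have := metric_triangle x (gamma s) (gamma v).
      have := metric_triangle x (gamma v) (gamma s).
      by rewrite (metric_sym (gamma v) (gamma s)); lra.
    by rewrite ler_norml; lra.
rewrite integral_cst//= /mu1 lebesgue_measure_itv /= lte_fin.
have [{}st|ts] := ltP s t; last first.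
  have -> : t = s by apply/eqP; rewrite eq_le st ts.
  by rewrite subrr mulr0 mule0.
rewrite -EFinB -EFinM lee_fin; apply: ler_wpM2r; first by rewrite subr_ge0 ltW.
by rewrite /k le_max lexx orbT.
Qed.

(** Summing [integral_step] over [N] equal steps of length [h] leaves the error [2 * l * h], which
    is arbitrarily small. *)
Lemma cutoff_upper_gradient : upper_gradient_along (fun y => (cutoff y)%:E)
  (fun y => (tent e (mdist x y) / e)%:E) gamma.
Proof.
split=> // _; rewrite -EFinB abse_EFin /curve_integral -/l.
have l0 : 0 < l by exact: arc_len_gt0.
have -> : (\int[lebesgue_measure]_(s in `[0%R, l])
    (tent e (mdist x (gamma s)) / e)%:E =
    e^-1%:E * \int[mu1]_(v in `[0%R, l]) (f v)%:E)%E.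
  rewrite -ge0_integralZl_EFin//=.
  - by apply: eq_integral => v _; rewrite -EFinM mulrC.
  - by move=> v _; rewrite lee_fin tent_ge0.
  - exact: f_meas.
  - by rewrite invr_ge0 ltW.
rewrite lee_pdivlMl// -EFinM; apply/lee_addgt0Pr => d d0.
(* The first summand ensures [2 * l * h <= d], the second one [h < e / 2]. *)
pose N := (Num.trunc (2 * l ^+ 2 / d + 2 * l / e)).+1.
have NP : 2 * l ^+ 2 / d + 2 * l / e < N%:R by exact: truncnS_gt.
have N0 : 0 < N%:R :> R by rewrite ltr0n.
pose h := l / N%:R.
have h0 : 0 < h by rewrite divr_gt0.
have a0 : 0 <= 2 * l ^+ 2 / d.
  by rewrite divr_ge0// ?mulr_ge0// ?sqr_ge0// ltW.
have b0 : 0 <= 2 * l / e by rewrite divr_ge0// ?mulr_ge0// ltW.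
have he : h < e / 2.
  rewrite /h ltr_pdivrMr// -ltr_pdivrMl ?divr_gt0//.
  have -> : (e / 2)^-1 * l = 2 * l / e by rewrite invfM invrK mulrC mulrA mulrC mulrA.
  lra.
have hd : 2 * l * h <= d.
  rewrite /h mulrA ler_pdivrMr// [d * _]mulrC -ler_pdivrMr//.
  have -> : 2 * l * l / d = 2 * l ^+ 2 / d by rewrite expr2 !mulrA.
  lra.
have main k : (k <= N)%N ->
    ((e * `|cutoff (gamma 0) - cutoff (gamma (k%:R * h))|)%:E <=
     \int[mu1]_(v in `[0%R, (k%:R * h)%R]) (f v)%:E + (k%:R * (2 * h ^+ 2))%:E)%E.
  elim: k => [|k IH] kN.
    rewrite !mul0r subrr normr0 mulr0 adde0; apply: integral_ge0 => v _.
    by rewrite lee_fin tent_ge0.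
  have kl : k.+1%:R * h <= l.
    by rewrite /h mulrA ler_pdivrMr// mulrC ler_pM2l// ler_nat.
  have k0 : 0 <= k%:R * h by rewrite mulr_ge0// ltW.
  have kk : k%:R * h <= k.+1%:R * h by rewrite ler_pM2r// ler_nat.
  have kh : k.+1%:R * h - k%:R * h = h by rewrite -mulrBl -natr1 addrAC subrr add0r mul1r.
  have := integral_step k0 kk kl; rewrite kh => /(_ he) step.
  rewrite -[k.+1%:R in X in (_ <= _ + X)%E]natr1 mulrDl mul1r.
  rewrite [X in (_ <= _ + X%:E)%E]addrC EFinD addeA.
  apply: (@le_trans _ _ ((e * `|cutoff (gamma 0) - cutoff (gamma (k%:R * h))|)%:E +
    (e * `|cutoff (gamma (k%:R * h)) - cutoff (gamma (k.+1%:R * h))|)%:E)%E).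
    rewrite -EFinD lee_fin -mulrDr ler_pM2l//.
    exact: ler_distD.
  apply: (le_trans (leeD2r _ (IH (ltnW kN)))).
  by rewrite [leLHS]addeAC; exact: leeD2r.
have Nh : N%:R * h = l by rewrite /h mulrC divfK// gt_eqF.
have := main N (leqnn N); rewrite Nh => H.
apply: (le_trans H); apply: leeD2l; rewrite lee_fin.
by rewrite expr2 mulrCA mulrA mulrA -[2 * N%:R * h]mulrA Nh.
Qed.

End curves.

(** * From the Poincare inequality to the splitting of balls *)

Section poincare_splitting.
Context {R : realType} {X : pointedMetricType R}.
Variables (mu : {measure set (borel X) -> \bar R}) (p : R).
Hypotheses (hmu : balls_pos_finite mu) (hp : 1 <= p).
Implicit Types (x y : X) (r : R) (V W : set X).

Let p0 : 0 < p. Proof. exact: lt_le_trans hp. Qed.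

Let ballM x r : measurable (ball x r : set (borel X)).
Proof. by apply: open_measurable_borel; exact: mball_open. Qed.

Lemma bounded_support_energy (h : X -> R) (K : R) x r :
  measurable_fun [set: borel X] (h : borel X -> R) -> 0 < r ->
  (forall y, 0 <= h y <= K) -> (forall y, r <= mdist x y -> h y = 0) ->
  (p_energy mu p (fun y => (h y)%:E) < +oo)%E.
Proof.
move=> mh r0 hK hr.
have mu_fin : (mu (ball x r) < +oo)%E by have /andP[] := hmu x r0.
apply: (@le_lt_trans _ _ (\int[mu]_(y in (ball x r : set (borel X))) cst (K `^ p)%:E y)%E).
  rewrite /p_energy [leRHS]integral_mkcond; apply: ge0_le_integral => //=.
  - apply/measurable_EFinP; apply: (measurableT_comp (measurable_powR p)).
    exact: measurableT_comp mh.
  - exact: ((measurable_restrictT _ (ballM x r)).1 (@measurable_cst _ _ _ _ _ _)).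
  - move=> y _; rewrite patchE; case: ifPn => [_|].
      have /andP[h0 h1] := hK y.
      rewrite lee_fin ger0_norm//; apply: ge0_ler_powR; rewrite ?nnegrE//.
      + exact: ltW.
      + exact: le_trans h1.
    rewrite notin_setE ballEmdist /= => /negP; rewrite -leNgt => /hr ->.
    by rewrite normr0 powR0// gt_eqF.
by rewrite integral_cst//= lte_mul_pinfty// lee_fin powR_ge0.
Qed.

Lemma exceptional0 : exceptional mu p (@set0 (arc_curve X)).
Proof.
exists (fun=> 0%E); split=> //.
  by split=> //; exact: measurable_cst.
rewrite /p_energy (eq_integral (cst 0%E)) ?integral0// => y _.
by rewrite abse0 poweR0r// gt_eqF.
Qed.

Lemma poincare_ball_splitting : poincare mu p ->
  exists2 c, 1 <= c & @ball_splitting R X c.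
Proof.
move=> [C [lam [C0 lam1 HP]]]; exists (2 * lam); first lra.
move=> x r V W r0 oV oW VW0 xVW Vx.
pose e := r / 8; have e0 : 0 < e by rewrite divr_gt0.
have e_ge0 := ltW e0.
have e8 : 8 * e = r by rewrite /e mulrC divfK.
pose u y : \bar R := (cutoff x e V y)%:E.
pose g y : \bar R := (tent e (mdist x y) / e)%:E.
have mcut : measurable_fun [set: borel X] (cutoff x e V : borel X -> R).
  rewrite (_ : cutoff x e V = fun y => \1_V y * ramp e (mdist x y)); last first.
    apply/funext => y; rewrite /cutoff indicE; case: ifPn => [/asboolP Vy|/asboolPn nVy].
      by rewrite mem_set// mul1r.
    by rewrite memNset// mul0r.
  apply: measurable_funM; first by apply: measurable_indic; exact: open_measurable_borel.
  by apply: continuous_borel; exact: ramp_dist_continuous.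
have mtent : measurable_fun [set: borel X]
    ((fun y => tent e (mdist x y) / e) : borel X -> R).
  apply: measurable_funM; last exact: measurable_cst.
  by apply: continuous_borel; exact: tent_dist_continuous.
have gNN : nonneg_borel g.
  split; first exact/measurable_EFinP.
  by move=> y; rewrite lee_fin divr_ge0// tent_ge0.
have g_ug gamma : upper_gradient_along u g gamma.
  by apply: (@cutoff_upper_gradient _ _ gamma x e V W) => //; rewrite e8.
have u_en : (p_energy mu p u < +oo)%E.
  apply: (@bounded_support_energy _ (2 * e) x r) => // y.
    rewrite /cutoff; case: ifP => _; last by rewrite lexx mulr_ge0.
    by rewrite ramp_ge0 ramp_le.
  by move=> ry; rewrite /cutoff; case: ifP => // _; rewrite ramp_far//; lra.
have g_en : (p_energy mu p g < +oo)%E.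
  apply: (@bounded_support_energy _ 2 x r) => // y.
    by rewrite divr_ge0 ?tent_ge0//= ler_pdivrMr// tent_le.
  by move=> ry; rewrite tent_far ?mul0r//; lra.
have u_newt : newtonian mu p u.
  split; first exact/measurable_EFinP.
  rewrite lte_add_pinfty//; apply: le_lt_trans g_en.
  by apply: ereal_inf_lbound; exists g.
have lam0 : 0 < lam by lra.
pose r' := r / (2 * lam).
have r'0 : 0 < r' by rewrite divr_gt0// mulr_gt0.
have [g' [[[g'_meas g'0] g'w] g'_en g'_min]] := HP x r' u r'0 u_newt.
(* The enlarged ball has radius [r / 2], exactly where the tent still vanishes. *)
rewrite (_ : lam * r' = 4 * e); last first.
  by rewrite /r' /e; field; rewrite gt_eqF.
set B := ball x r'; set m := mean mu B u => /=.
have gg' : {ae mu, forall y, ball x (4 * e) y -> g' y = 0%E}.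
  have : {ae mu, forall y, (g' y <= g y)%E}.
    apply: g'_min => //; split=> //; exists set0 => //; exact: exceptional0.
  move=> [N [mN muN HN]]; exists N; split=> // y nH; apply: HN => g'g.
  apply: nH; rewrite ballEmdist /= => xy.
  apply/eqP; rewrite eq_le g'0 andbT; apply: le_trans g'g _.
  by rewrite /g tent_near ?mul0r// ltW.
have -> : mean mu (ball x (4 * e)) (fun y => (g' y `^ p)%E) = 0%E.
  rewrite /mean (_ : integral _ _ _ = 0%E) ?mule0//.
  rewrite (ae_eq_integral (cst 0%E)) ?integral0//.
  - apply: (measurableT_comp (measurable_poweR p)).
    exact: measurable_funTS.
  - move: gg' => [N [mN muN HN]]; exists N; split=> // y nH; apply: HN => H.
    by apply: nH => /H ->; rewrite poweR0r// gt_eqF.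
rewrite poweR0r ?invr_neq0 ?gt_eqF// mule0 => mB.
have /andP[muB0 muBoo] := hmu x r'0.
have mBM : measurable (B : set (borel X)) by exact: ballM.
have um : measurable_fun (B : set (borel X)) (fun y => (u y - m)%E : \bar R).
  apply: emeasurable_funB; last exact: measurable_cst.
  by apply: measurable_funTS; exact/measurable_EFinP.
have : (\int[mu]_(y in (B : set (borel X))) `|u y - m| = 0)%E.
  apply/eqP; rewrite eq_le integral_ge0// andbT.
  move: mB; rewrite /mean => mB.
  have inv0 : (0 < (mu B)^-1)%E.
    by rewrite inve_gt0 ?(gt_eqF muB0) ?(lt_eqF muBoo).
  by move: mB; rewrite pmule_rle0.
move/(ae_eq_integral_abs mu mBM um) => uae.
(* A nonempty open set contains a ball of positive measure, so it has a point where [u] equals its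
   mean [m]. Applied to the traces of [V] and [W] on [B], this gives the two values [2 * e] and [0]
   for [m]. *)
have hit (A : set X) : open A -> A !=set0 -> A `<=` B ->
    exists2 y, A y & (u y - m = 0)%E.
  move=> oA [y Ay] AB; apply: contrapT => nA.
  have [N [mN muN HN]] := uae.
  have /open_ballP/(_ _ Ay)[d d0 dA] := oA.
  have : (mu (ball y d) <= mu N)%E.
    apply: le_measure; rewrite ?inE// => z /dA Az; apply: HN => /= H.
    by apply: nA; exists z => //; apply: H; exact: AB.
  by rewrite muN leNgt; have /andP[->] := hmu y d0.
have oB : open B by exact: mball_open.
have Br : B `<=` ball x (4 * e).
  move=> y; rewrite /B !ballEmdist /= => xy.
  apply: lt_le_trans xy _; rewrite /r' ler_pdivrMr ?mulr_gt0//.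
  have : 4 * e * 2 <= 4 * e * (2 * lam) by rewrite ler_pM2l; lra.
  lra.
have mE : m = (2 * e)%:E.
  have [|||y [By Vy]] := hit (B `&` V).
  - exact: openI.
  - by exists x; split=> //; exact: ballxx.
  - exact: subIsetl.
  have := Br _ By; rewrite ballEmdist /= => xy.
  rewrite /u /cutoff asboolT// ramp_near//; last lra.
  (* An infinite [m] would contradict the equation itself. *)
  by case: (m) => [m'||] //= [h]; congr EFin; lra.
move=> y By; apply: contrapT => nVy.
have Wy : W y.
  have : (V `|` W) y.
    apply: xVW; have := Br _ By; rewrite !ballEmdist /=; lra.
  by case.
have [|||z [Bz Wz]] := hit (B `&` W).
- exact: openI.
- by exists y.
- exact: subIsetl.
have nVz : ~ V z by move=> Vz; rewrite -[False]/(set0 z) -VW0.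
rewrite /u /cutoff asboolF// mE => -[]; lra.
Qed.

End poincare_splitting.

(** * Ends and accessibility *)

Section ends.
Context {R : realType} {X : completeMetricType R}.
Implicit Types (x y : X) (r c e s t : R) (Omega : set X) (E F : nat -> set X).

Lemma path01_within (g : R -> X) : path01 g -> {within `[0, 1], continuous g}.
Proof.
move=> gc; apply/subspace_continuousP => t /=; rewrite in_itv /= => t01 A.
move=> /nbhs_ballP[e /= e0 eA]; have [d d0 H] := gc _ t01 _ e0.
apply/nbhs_ballP; exists d => // s; rewrite -ball_normE /= distrC => std.
by rewrite in_itv /= => s01; apply: eA; rewrite ballEmdist /=; exact: H.
Qed.

Lemma within_tail (g : R -> X) e : {within `[0, 1], continuous g} -> 0 < e ->
  exists2 s, 0 <= s < 1 & forall t, s <= t -> t < 1 -> ball (g 1) e (g t).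
Proof.
move=> /subspace_continuousP gc e0.
have I1 : `[0, 1]%classic (1 : R) by rewrite /= in_itv /= lexx ler01.
have /nbhs_ballP[d /= d0 H] := gc 1 I1 (ball (g 1) e) (nbhsx_ballx _ _ e0).
exists (Num.max 0 (1 - d / 2)).
  by rewrite le_max lexx /= gt_max ltr01; lra.
move=> t; rewrite ge_max => /andP[t0 td] t1; apply: H.
  by rewrite -ball_normE /= ger0_norm ?subr_ge0; lra.
by rewrite /= in_itv /= t0 ltW.
Qed.

Lemma tail_connected (g : R -> X) s : {within `[0, 1], continuous g} ->
  0 <= s -> connected (g @` `[s, 1[).
Proof.
move=> gc s0; apply: connected_continuous_connected.
  by apply/connected_intervalP; exact: interval_is_interval.
apply: (continuous_subspaceW _ gc) => t /=.
by rewrite !in_itv /= => /andP[st t1]; rewrite (le_trans s0 st) ltW.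
Qed.

(** * Consecutive members of a chain *)

Section chain_facts.
Variables (Omega : set X) (E : nat -> set X).
Hypothesis hE : is_chain Omega E.

Lemma chain_sub k : E k `<=` Omega.
Proof. by have [H _ _ _] := hE; have [_ _ []] := H k. Qed.

Lemma chain_nonincreasing k j : (k <= j)%N -> E j `<=` E k.
Proof.
have [_ H _ _] := hE.
move=> /subnKC <-; elim: (j - k)%N => [|i IH]; first by rewrite addn0.
by rewrite addnS; apply: subset_trans IH; exact: H.
Qed.

Lemma chain_nonempty k : E k !=set0.
Proof.
have [H _ _ _] := hE; have [_ _ _ [y [Ey _]]] := H k.
by have [z [Ez _]] := Ey setT filterT; exists z.
Qed.

Lemma chain_boundary_dist k y z : Omega y -> Omega z ->
  boundary (E k.+1) y -> boundary (E k) z ->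
  (set_dist (Omega `&` boundary (E k.+1)) (Omega `&` boundary (E k)) <=
    (mdist y z)%:E)%E.
Proof.
by move=> Oy Oz Ey Ez; apply: ereal_inf_lbound; exists y => //; exists z.
Qed.

(** A point of [E k.+1] outside the interior of [E k] would lie on both boundaries, forcing their
    distance to be [0]. *)
Lemma chain_interior k : E k.+1 `<=` (E k)°.
Proof.
have [_ Edec Edist _] := hE.
move=> y Ey; apply: contrapT => nEy.
have Oy : Omega y := chain_sub Ey.
suff h : (set_dist (Omega `&` boundary (E k.+1)) (Omega `&` boundary (E k)) <=
    (mdist y y)%:E)%E by have := lt_le_trans (Edist k) h; rewrite mdistxx ltxx.
apply: chain_boundary_dist => //; split.
- exact: subset_closure.
- by move=> /(interiorS (Edec k)).
- exact/subset_closure/Edec.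
- exact: nEy.
Qed.

(** The connected set [E k.+1] lies in one component of the interior of [E k], and this component is
    open. *)
Lemma chain_points_joined c k y z : 1 <= c -> @ball_splitting R X c ->
  E k.+1 y -> E k.+1 z -> joined (E k) y z.
Proof.
move=> c1 bs Ey Ez; have c0 : 0 < c by lra.
have cE : connected (E k.+1) by have [H _ _ _] := hE; have [] := H k.+1.
have Uz : connected_component (E k)° y z.
  exact: (connected_component_max Ey (@chain_interior k) cE).
have Uy := @connected_component_refl X _ y (chain_interior Ey).
have oU := component_open y c0 bs (@open_interior _ (E k)).
have [g [gc g0 g1 gU]] := open_connected_joined c1 bs oU
  (@component_connected X _ y) Uy Uz.
exists g; split=> // t /gU /connected_component_sub; exact: interior_subset.
Qed.

End chain_facts.

Lemma singleton_accessible Omega E x c : is_chain Omega E -> 1 <= c ->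
  @ball_splitting R X c -> chain_impression E = [set x] ->
  (forall e, 0 < e -> exists k, E k `<=` ball x e) ->
  accessible_through Omega E x.
Proof.
move=> hE c1 bs Ex shrink.
split; first by have [_ _ _] := hE; apply; rewrite Ex.
have [w wE] := choice (chain_nonempty hE).
(* Both points lie in [E k.+1], so the curve between them can be kept in [E k]. *)
have wj k : joined (E k) (w k.+1) (w k.+2).
  apply: (chain_points_joined hE c1 bs) => //.
  exact: (chain_nonincreasing hE (leqnSn k.+1)).
have [p pP] := choice wj.
have pc k : path01 (p k) by have [] := pP k.
have pS k : p k 1 = p k.+1 0.
  by have [_ _ -> _] := pP k; have [_ -> _ _] := pP k.+1.
have pasteE u k : 0 <= u -> k%:R <= u -> E k (paste p u).
  move=> u0 ku; have /andP[lo hi] := truncn_itv u0.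
  apply: (chain_nonincreasing hE (_ : k <= Num.trunc u)%N).
    by rewrite truncn_ge_nat.
  have [_ _ _] := pP (Num.trunc u); apply.
  by rewrite -natr1 in hi; lra.
pose gam t := if t < 1 then paste p (t / (1 - t)) else x.
(* At [tk k] the reparametrization [t / (1 - t)] takes the value [k + 1]; using [k + 1] rather than
   [k] keeps [tk 0] positive. *)
pose tk k : R := k.+1%:R / k.+2%:R.
have tk01 k : 0 < tk k < 1.
  by rewrite /tk divr_gt0 ?ltr0n//= ltr_pdivrMr ?ltr0n// mul1r ltr_nat.
have tail k t : tk k <= t -> t < 1 -> E k (gam t).
  move=> kt t1; have /andP[tk0 _] := tk01 k.
  have t0 : 0 <= t by lra.
  have t1' : 0 < 1 - t by lra.
  rewrite /gam t1; apply: pasteE; first by rewrite divr_ge0// ltW.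
  move: kt; rewrite /tk ler_pdivrMr ?ltr0n// ler_pdivlMr// -!natr1.
  move: (k%:R) => q; lra.
exists gam; split.
- apply: path01_within => t /andP[t0 t1] e e0.
  have [{}t1|] := ltP t 1; last first.
    move=> t1'; have -> : t = 1 by lra.
    have [k Ek] := shrink e e0; have /andP[tk0 tk1] := tk01 k.
    exists (1 - tk k); first lra.
    move=> s /andP[s0 s1] std; rewrite {1}/gam ltxx.
    have [s1'|s1'] := ltP s 1; last first.
      by rewrite /gam (ltNge s 1) s1' /= mdistxx.
    have : ball x e (gam s); last by rewrite ballEmdist.
    by apply: Ek; apply: tail => //; move: std; rewrite ltr_norml; lra.
  have t1' : 0 < 1 - t by lra.
  have [d d0 H] := paste_continuous pc pS (divr_ge0 t0 (ltW t1')) e0.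
  have t2 : 0 < (1 - t) ^+ 2 / 2 by rewrite divr_gt0// exprn_gt0.
  (* The first bound gives [1 - s > (1 - t) / 2], so the second one keeps the reparametrized points
     closer than [d]. *)
  exists (Num.min ((1 - t) / 2) (d * ((1 - t) ^+ 2 / 2))).
    by rewrite lt_min divr_gt0//= mulr_gt0.
  move=> s /andP[s0 s1]; rewrite lt_min => /andP[st1 st2].
  have hs : (1 - t) / 2 < 1 - s by move: st1; rewrite ltr_norml; lra.
  have s1' : 0 < 1 - s by lra.
  rewrite /gam t1 (_ : s < 1) ?subr_gt0//; last by rewrite -subr_gt0.
  apply: H; first by rewrite divr_ge0// ltW.
  have -> : s / (1 - s) - t / (1 - t) = (s - t) / ((1 - s) * (1 - t)).
    by field; rewrite !gt_eqF.
  rewrite normrM normfV [X in _ / X]ger0_norm; last by rewrite ltW ?mulr_gt0.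
  rewrite ltr_pdivrMr ?mulr_gt0//; apply: lt_le_trans st2 _.
  by rewrite ler_pM2l// expr2 mulrAC ler_pM2r// ltW.
- by rewrite /gam ltxx.
- move=> t t0 t1; apply: (chain_sub hE (k := 0)); rewrite /gam t1.
  by apply: pasteE; rewrite divr_ge0// subr_ge0 ltW.
- move=> k; exists (tk k); have /andP[? ?] := tk01 k; split=> // t.
  exact: tail.
Qed.

(** * The chain of components along an accessing curve *)

Section accessible_chain.
Variables (Omega : set X) (E : nat -> set X) (x : X) (c : R) (gam : R -> X).
Hypotheses (c0 : 0 < c) (bs : @ball_splitting R X c) (oO : open Omega)
  (hE : is_chain Omega E) (bx : boundary Omega x)
  (gc : {within `[0, 1], continuous gam}) (g1 : gam 1 = x)
  (gO : forall t, 0 <= t -> t < 1 -> Omega (gam t))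
  (gE : forall k, exists tk : R, [/\ 0 < tk, tk < 1 &
      forall t, tk <= t -> t < 1 -> E k (gam t)]).
Variables (r : nat -> R) (s : nat -> R).
Hypotheses (r0 : forall k, 0 < r k) (rS : forall k, r k.+1 < r k)
  (r_small : forall e, 0 < e -> exists k, r k < e)
  (r_proper : exists2 y, Omega y & r 0%N <= mdist x y)
  (s01 : forall k, 0 <= s k < 1)
  (sP : forall k t, s k <= t -> t < 1 -> ball x (r k) (gam t)).

Let U k := Omega `&` ball x (r k).

Definition tail_component k := connected_component (U k) (gam (s k)).
Local Notation F := tail_component.

Let oU k : open (U k).
Proof. by apply: openI => //; exact: mball_open. Qed.

Let F_tail k t : s k <= t -> t < 1 -> F k (gam t).
Proof.
move=> st t1; have /andP[s0 s1] := s01 k.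
apply: (@connected_component_max X _ (gam @` `[s k, 1[) (gam (s k))).
- by exists (s k) => //=; rewrite in_itv /= lexx.
- move=> _ [v /= + <-]; rewrite in_itv /= => /andP[sv v1]; split.
    by apply: gO => //; exact: le_trans sv.
  exact: sP.
- exact: tail_connected.
- by exists t => //=; rewrite in_itv /= st.
Qed.

Let F_common k t0 : t0 < 1 -> exists t, [/\ s k <= t, t0 <= t & t < 1].
Proof.
move=> h; exists (Num.max (s k) t0); have /andP[_ s1] := s01 k.
by rewrite !le_max !lexx orbT gt_max s1.
Qed.

Let F_sub k : F k `<=` U k.
Proof. exact: connected_component_sub. Qed.

Let F_open k : open (F k).
Proof. exact: component_open c0 bs (oU k). Qed.

(** The two components share a point of the curve close to its end. *)
Let F_nonincreasing k : F k.+1 `<=` F k.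
Proof.
have /andP[_ s1] := s01 k.
have [t [st1 st t1]] := F_common k.+1 s1.
have Fkt := F_tail st t1; have Fk1t := F_tail st1 t1.
rewrite {2}/F (same_connected_component Fkt).
apply: connected_component_max => //; last exact: component_connected.
move=> y /F_sub [Oy]; rewrite ballEmdist /= => xy; split=> //.
by rewrite ballEmdist /=; exact: lt_trans (rS k).
Qed.

Let F_closure_dist k y : closure (F k) y -> mdist x y <= r k.
Proof.
move=> Fy; rewrite leNgt; apply/negP => xy.
have d0 : 0 < mdist x y - r k by rewrite subr_gt0.
have [z [/F_sub [_ +]]] := Fy _ (nbhsx_ballx y _ d0).
rewrite !ballEmdist /= => xz yz.
by have := metric_triangle x z y; rewrite (metric_sym z y); lra.
Qed.

(** A boundary point in [U k] would have an open component meeting [F k], hence equal to it. So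
    boundaries inside [Omega] lie on spheres about [x], and different radii keep them apart. *)
Let F_boundary k y : Omega y -> boundary (F k) y -> mdist x y = r k.
Proof.
move=> Oy [cFy nFy]; apply/eqP; rewrite eq_le F_closure_dist//= leNgt.
apply/negP => xy; apply: nFy.
have Uy : U k y by split=> //; rewrite ballEmdist.
have Cy := @connected_component_refl X _ y Uy.
have oC := component_open y c0 bs (oU k).
have [z [Fz Cz]] := cFy _ (open_nbhs_nbhs (conj oC Cy)).
suff Fy : F k y by apply: open_nbhs_nbhs; split.
rewrite /F (same_connected_component Fz).
exact: connected_component_sym.
Qed.

Let F_closure k : closure (F k) x.
Proof.
move=> A /nbhs_ballP[e /= e0 eA].
have [j je] := r_small e0; have /andP[_ sj1] := s01 j.
have [t [kt jt t1]] := F_common k sj1.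
exists (gam t); split; first exact: F_tail.
by apply: eA; have := sP jt t1; rewrite !ballEmdist /=; lra.
Qed.

Lemma tail_component_impression : chain_impression F = [set x].
Proof.
apply/seteqP; split=> [y Fy|_ -> k _]; last exact: F_closure.
apply/esym/mdist_positivity/eqP; rewrite eq_le mdist_ge0 andbT.
apply/ler_addgt0Pr => e e0; rewrite add0r.
have [k ke] := r_small e0.
by apply: le_trans (F_closure_dist (Fy k I)) (ltW ke).
Qed.

Lemma tail_component_chain : is_chain Omega F.
Proof.
split=> //.
- move=> k; split.
  + by exists x, (r k) => y /F_sub[].
  + exact: component_connected.
  + split; first by move=> y /F_sub[].
    (* This [y] lies outside the largest ball, so no [F k] is all of [Omega]. *)
    have [y Oy ry] := r_proper => /(_ _ Oy) Fy.
    have : F 0 y by elim: (k) Fy => // j IH /F_nonincreasing.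
    by move=> /F_sub[_]; rewrite ballEmdist /= ltNge ry.
  + by exists x; split.
- move=> k; apply: (@lt_le_trans _ _ (r k - r k.+1)%:E).
    by rewrite lte_fin subr_gt0.
  apply/ereal_infP => _ [y [Oy Fy] [z [Oz Fz] <-]]; rewrite lee_fin.
  have := F_boundary Oy Fy; have := F_boundary Oz Fz.
  by have := metric_triangle x y z; lra.
- by rewrite tail_component_impression => _ ->.
Qed.

(* A small connected set that meets E_{k+1} but is not contained in E_k meets
   both boundaries, which lie at a positive distance from each other. *)
Lemma tail_component_divides : chain_divides F E.
Proof.
move=> k; have [_ Edec Edist _] := hE.
pose dist := set_dist (Omega `&` boundary (E k.+1)) (Omega `&` boundary (E k)).
have [e e0 eD] : exists2 e : R, 0 < e & (e%:E <= dist)%E.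
  move: (Edist k); rewrite -/dist; case: (dist) => [d d0|_|//]; first by exists d.
  (* The distance is [+oo] when one of the boundaries misses [Omega]; any positive [e] then
     works. *)
  by exists 1 => //; rewrite leey.
have [|l le] := r_small (_ : 0 < e / 2); first lra.
exists l; apply: contrapT => nFE.
have cF : connected (F l) by exact: component_connected.
have [t' [_ t'1 Et']] := gE k.+1.
have [t [st tt t1]] := F_common l t'1.
have FEt : (F l `&` E k.+1) (gam t).
  by split; [exact: F_tail|exact: Et'].
have [y [Fy Ey]] : F l `&` boundary (E k.+1) !=set0.
  apply: connected_boundary => //; first by exists (gam t).
  by move=> FE; apply: nFE; exact: subset_trans (Edec k).
have [z [Fz Ez]] : F l `&` boundary (E k) !=set0.
  apply: connected_boundary => //; exists (gam t).
  by case: FEt => ? ?; split=> //; exact: Edec.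
have [Oy xy] := F_sub Fy; have [Oz xz] := F_sub Fz.
have := le_trans eD (chain_boundary_dist Oy Oz Ey Ez).
rewrite lee_fin; move: xy xz; rewrite !ballEmdist /= => xy xz.
by have := metric_triangle y x z; rewrite (metric_sym y x); lra.
Qed.

End accessible_chain.

Lemma accessible_divisor Omega E x c : 0 < c -> @ball_splitting R X c ->
  open Omega -> Omega !=set0 -> is_chain Omega E ->
  accessible_through Omega E x ->
  exists F, [/\ is_chain Omega F, chain_divides F E &
    chain_impression F = [set x]].
Proof.
move=> c0 bs oO [y Oy] hE [bx [gam [gc g1 gO gE]]].
have xy : 0 < mdist x y.
  rewrite mdist_gt0; apply/eqP => xy; case: bx => _; apply.
  by rewrite xy; apply: open_nbhs_nbhs.
(* The point [x] is outside the open set [Omega], so [mdist x y] is positive; as [r 0] equals it,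
   [y] is the witness for [r_proper]. *)
pose r k : R := mdist x y / k.+1%:R.
have r0 k : 0 < r k by rewrite divr_gt0.
have rS k : r k.+1 < r k by rewrite ltr_pM2l// ltf_pV2 ?posrE// ltr_nat.
have r_small e : 0 < e -> exists k, r k < e.
  move=> e0; exists (Num.trunc (mdist x y / e)).
  by rewrite ltr_pdivrMr// mulrC -ltr_pdivrMr//; exact: truncnS_gt.
have tails k : exists s, 0 <= s < 1 /\
    forall t, s <= t -> t < 1 -> ball x (r k) (gam t).
  by have [s s01 H] := within_tail gc (r0 k); exists s; rewrite -g1.
have [s sP] := choice tails.
have s01 k : 0 <= s k < 1 by have [] := sP k.
have {}sP k t : s k <= t -> t < 1 -> ball x (r k) (gam t).
  by have [_] := sP k; apply.
have r_proper : exists2 y, Omega y & r 0%N <= mdist x y.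
  by exists y => //; rewrite /r divr1.
exists (tail_component Omega x gam r s); split.
- exact: (tail_component_chain c0 bs).
- exact: (tail_component_divides hE).
- exact: tail_component_impression.
Qed.

End ends.

Theorem corollary7p11 (R : realType) (X : completeMetricType R)
    (mu : {measure set (borel X) -> \bar R}) (p : R)
    (hX : exists x y : X, x <> y)
    (hmu : balls_pos_finite mu)
    (hp : 1 <= p)
    (hdoubling : doubling mu)
    (hpoincare : poincare mu p)
    (Omega : set X)
    (hOmega : bounded_domain Omega)
    (hOmegaX : Omega `<` [set: X])
    (E : nat -> set X)
    (hE : is_chain Omega E)
    (hprime : prime_end Omega (end_of Omega E)) :
  singleton_end Omega (end_of Omega E) <->
  exists x : X, end_impression (end_of Omega E) x /\
    accessible_through Omega E x.
Proof.
have [_ O0 _ oO] := hOmega.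
have [c c1 bs] := poincare_ball_splitting hmu hp hpoincare.
have c0 : 0 < c by lra.
split=> [[_ [x Ex]]|[x [_ xE]]].
  exists x; rewrite Ex; split=> //.
  rewrite end_impressionE// in Ex.
  apply: (singleton_accessible hE c1 bs Ex) => e e0.
  have [Eacc Edec _ _] := hE; have [bE _ _ _] := Eacc 0%N.
  exact: (nested_shrink hmu hdoubling bE Edec Ex e0).
split; first by exists E.
have [F [hF FE Fx]] := accessible_divisor c0 bs oO O0 hE xE.
(* Primality identifies the end of [F], which divides that of [E], with the end of [E]; so the
   impression is that of [F]. *)
exists x; rewrite -(hprime.2 (end_of Omega F)).
- by rewrite end_impressionE.
- by exists F.
- exact/end_dividesE.
Qed.
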